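(* Let $B$ be a unital complex Banach algebra and let $(A,E)$ be a $B$-valued Banach noncommutative probability space. Let $x,y\in A$ be free in $(A,E)$ and assume that both $E(x)$ and $E(y)$ are invertible elements of $B$. Then, as germs of analytic functions at $0$ (i.e. for all $b$ in some neighborhood of $0$ in $B$), \[ S_{xy}(b)=S_y(b)\,S_x\big(S_y(b)^{-1}\,b\,S_y(b)\big). \]
   Context: A $B$-valued Banach noncommutative probability space is a pair $(A,E)$ where $A$ is a unital Banach algebra containing an isometrically embedded copy of $B$ as a unital subalgebra and $E:A\to B$ is a bounded projection satisfying $E(b_1ab_2)=b_1E(a)b_2$ for $a\in A$, $b_1,b_2\in B$. Elements $x,y\in A$ are free if, letting $A_1$ (resp. $A_2$) be the unital subalgebra of $A$ generated by $B\cup\{x\}$ (resp. $B\cup\{y\}$), one has $E(a_1\cdots a_p)=0$ whenever $p\ge1$, $a_j\in A_{i_j}$, $i_1\ne i_2\ne\cdots\ne i_p$ (consecutive indices distinct) and $E(a_j)=0$ for all $j$. For $a\in A$ let $\Psi_a(b)=E((1-ba)^{-1})-1=\sum_{n\ge1}E((ba)^n)$ for $\|b\|<\|a\|^{-1}$. If $E(a)$ is invertible, the Fréchet derivative $h\mapsto hE(a)$ of $\Psi_a$ at $0$ is invertible, so $\Psi_a$ restricted to a neighborhood of $0$ has an analytic compositional inverse $\Psi_a^{\langle-1\rangle}$ defined near $0$ with $\Psi_a^{\langle -1\rangle}(0)=0$. There is a unique $B$-valued analytic function $H_a$ near $0$ with $\Psi_a^{\langle-1\rangle}(b)=bH_a(b)$,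 and the S-transform of $a$ is the analytic function $S_a(b)=(1+b)H_a(b)$ defined near $0$; note $S_a(0)=E(a)^{-1}$. *)

(* Defs.v *)
From HB Require Import structures.
From mathcomp Require Import all_boot all_order all_algebra.
From mathcomp Require Import all_classical all_reals all_analysis.
From mathcomp Require Export complex.
Export Order.TTheory GRing.Theory Num.Theory.
Export numFieldTopology.Exports numFieldNormedType.Exports.

Set Implicit Arguments.
Unset Strict Implicit.
Unset Printing Implicit Defensive.

Local Open Scope ring_scope.
Local Open Scope classical_set_scope.

(* Hierarchy-Builder cannot join normed-module and ring structures on one    *)
(* carrier (the join would have to precede Num.NumDomain), so a unital        *)
(* Banach algebra over K is a Banach space A : completeNormedModType K        *)
(* together with a multiplication and a unit satisfying the axioms of a       *)
(* unital associative K-algebra with submultiplicative norm.                  *)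
Record banach_alg (K : numFieldType) (A : completeNormedModType K) := BanachAlg {
  bmul : A -> A -> A;
  bone : A;
  bmulA : forall x y z, bmul x (bmul y z) = bmul (bmul x y) z;
  bmul1l : forall x, bmul bone x = x;
  bmul1r : forall x, bmul x bone = x;
  bmulDl : forall x y z, bmul (x + y) z = bmul x z + bmul y z;
  bmulDr : forall x y z, bmul x (y + z) = bmul x y + bmul x z;
  bmulZl : forall (c : K) x y, bmul (c *: x) y = c *: bmul x y;
  bmulZr : forall (c : K) x y, bmul x (c *: y) = c *: bmul x y;
  bnormM : forall x y, `|bmul x y| <= `|x| * `|y|
}.

Section BanachAlgDefs.
Variables (K : numFieldType) (A : completeNormedModType K) (mA : banach_alg A).

Definition binvertible (a : A) : Prop :=
  exists c : A, bmul mA a c = bone mA /\ bmul mA c a = bone mA.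

Definition binv (a : A) : A :=
  xget 0 (fun c : A => bmul mA a c = bone mA /\ bmul mA c a = bone mA).

Definition bprod (s : seq A) : A := foldr (bmul mA) (bone mA) s.

End BanachAlgDefs.

Section BNCPS.
Variables (K : numFieldType) (B A : completeNormedModType K)
          (mB : banach_alg B) (mA : banach_alg A).

Definition banach_ncps (iota : B -> A) (E : A -> B) : Prop :=
  [/\
      (forall b1 b2 : B, iota (b1 + b2) = iota b1 + iota b2),
      (forall (c : K) (b : B), iota (c *: b) = c *: iota b),
      (forall b1 b2 : B, iota (bmul mB b1 b2) = bmul mA (iota b1) (iota b2)),
      iota (bone mB) = bone mA &
      (forall b : B, `|iota b| = `|b|)] /\
  [/\
      (forall a1 a2 : A, E (a1 + a2) = E a1 + E a2),
      (forall (c : K) (a : A), E (c *: a) = c *: E a),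
      (exists M : K, forall a : A, `|E a| <= M * `|a|),
      (forall b : B, E (iota b) = b) &
      (forall (b1 b2 : B) (a : A),
         E (bmul mA (bmul mA (iota b1) a) (iota b2))
         = bmul mB (bmul mB b1 (E a)) b2)].

Inductive gen_subalg (iota : B -> A) (x : A) : A -> Prop :=
  | gen_B (b : B) : gen_subalg iota x (iota b)
  | gen_x : gen_subalg iota x x
  | gen_add a1 a2 : gen_subalg iota x a1 -> gen_subalg iota x a2 ->
                    gen_subalg iota x (a1 + a2)
  | gen_mul a1 a2 : gen_subalg iota x a1 -> gen_subalg iota x a2 ->
                    gen_subalg iota x (bmul mA a1 a2)
  | gen_scale (c : K) a : gen_subalg iota x a -> gen_subalg iota x (c *: a).

(* Freeness of x and y in (A, E).  A word is a nonempty list of pairs         *)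
(* (i_j, a_j), with i_j : bool (true = the algebra A_1 generated by B and x,  *)
(* false = the algebra A_2 generated by B and y), consecutive indices        *)
(* distinct, a_j in A_{i_j} and E(a_j) = 0; then E(a_1 ... a_p) = 0.          *)
Definition free_in (iota : B -> A) (E : A -> B) (x y : A) : Prop :=
  forall s : seq (bool * A), s <> [::] ->
    (forall k : nat, (k.+1 < size s)%N ->
       (nth (true, 0) s k).1 <> (nth (true, 0) s k.+1).1) ->
    (forall k : nat, (k < size s)%N ->
       gen_subalg iota (if (nth (true, 0) s k).1 then x else y)
                  (nth (true, 0) s k).2
       /\ E (nth (true, 0) s k).2 = 0) ->
    E (bprod mA (map snd s)) = 0.

(* Psi_a(b) = E((1 - b a)^{-1}) - 1  (meaningful for b near 0). *)
Definition Psi (iota : B -> A) (E : A -> B) (a : A) (b : B) : B :=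
  E (binv mA (bone mA - bmul mA (iota b) a)) - bone mB.

(* f is analytic (= Frechet-holomorphic) on a neighbourhood of 0 in B. *)
Definition holo_near0 (f : B -> B) : Prop :=
  \forall b \near (0 : B), differentiable f b.

(* S is (a representative of the germ at 0 of) the S-transform of a:        *)
(* E(a) is invertible, Phi is an analytic compositional inverse of Psi_a     *)
(* near 0 with Phi 0 = 0, H is analytic near 0 with Phi(b) = b H(b) near 0,  *)
(* and S(b) = (1 + b) H(b) near 0.                                           *)
Definition is_S_transform (iota : B -> A) (E : A -> B) (a : A) (S : B -> B)
  : Prop :=
  binvertible mB (E a) /\
  exists Phi H : B -> B,
    [/\ Phi 0 = 0,
        holo_near0 Phi,
        (\forall b \near (0 : B), Psi iota E a (Phi b) = b) &
        (\forall b \near (0 : B), Phi (Psi iota E a b) = b)] /\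
    [/\ holo_near0 H,
        (\forall b \near (0 : B), Phi b = bmul mB b (H b)) &
        (\forall b \near (0 : B), S b = bmul mB (bone mB + b) (H b))].

End BNCPS.

(* Main.v *)
(* The heart of the matter is an algebraic identity. Put s = S_y(b),
   b' = s^-1 b s, h = H_y(b), k = H_x(b') and c = b s k. The element
   t = h y (1 - b h y)^-1 has conditional expectation 1, so does the conjugate
   r by s of k x (1 - b' k x)^-1, and
     (1 - c x y)^-1 = (1 + b t) N^-1 (1 + b r),  N = 1 + b - b (r - 1) (t - 1).
   Expanding N^-1 in a Neumann series, freeness kills everything except 1 + b,
   hence Psi_xy(c) = b, that is b H_xy(b) = b s k.
   The factor b is cancelled on both occasions where this is needed (E(t) = 1
   and the last step) because an analytic D with b D(b) = 0 near 0 vanishes: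
   b + z is invertible for |z| > |b|, so z |-> D(b + z) is holomorphic on a
   disc and vanishes near its boundary, and Cauchy's theorem (Goursat's proof,
   with midpoint sums in place of integrals) gives D(b) = 0. *)
Require Import Defs.
From HB Require Import structures.
From mathcomp Require Import all_boot all_order all_algebra.
From mathcomp Require Import all_classical all_reals all_analysis.
From mathcomp Require Import complex ring lra zify.
Import Order.TTheory GRing.Theory Num.Theory.
Import numFieldTopology.Exports numFieldNormedType.Exports.
Local Open Scope ring_scope.
Local Open Scope complex_scope.
Local Open Scope classical_set_scope.
Set Implicit Arguments.
Unset Strict Implicit.

(** * Real-valued norms and limits at 0 *)

(** Freeness concerns the algebraic subalgebras, whereas the resolvents lie only in their norm
    closures; it is therefore extended to the closures by approximation with centred elements.
    Conjugation by s is what lets the two resolvents meet. With U = (1 - b' k x)^-1 and W = (1 - b h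
    y)^-1, the relation c = s b' k gives s U s^-1 (1 - c x y) W = s U s^-1 W - s (U - 1) y W, and s
    = (1 + b) h turns s y W into (1 + b) t, so that only b, r and t are left. The weight 1 + b of
    the S-transform is exactly what completes the outcome to a product of centred factors.
    Cancelling b is an obstacle because b need not be invertible, while the functional equations
    give their conclusions only after multiplication by b. Since the remedy is translation by
    scalars, holomorphy in B is used along the complex lines b + C 1, as a matter of one complex
    variable with vector values. *)

Definition nm (R : realType) (V : normedModType R[i]) (v : V) : R := complex.Re `|v|.

Section Nm.
Variables (R : realType) (V : normedModType R[i]).
Implicit Types u v : V.

(** A norm over [R[i]] is itself a complex number; its imaginary part vanishes, so all estimates can
    be carried out in the ordered field [R]. *)
Lemma nmE v : `|v| = (nm v)%:C.
Proof.
have /ger0_Im := normr_ge0 v; rewrite /nm.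
by case: `|v| => a b /= ->.
Qed.

Lemma lt_nm v (e : R) : (`|v| < e%:C) = (nm v < e).
Proof. by rewrite nmE ltcR. Qed.

Lemma nm_ge0 v : 0 <= nm v.
Proof. by have := normr_ge0 v; rewrite nmE ler0c. Qed.

Lemma nm0 : nm (0 : V) = 0.
Proof. by rewrite /nm normr0. Qed.

Lemma nm_eq0 v : nm v = 0 -> v = 0.
Proof. by move=> h; apply/eqP; rewrite -normr_eq0 nmE h. Qed.

Lemma nmN v : nm (- v) = nm v.
Proof. by rewrite /nm normrN. Qed.

Lemma nmB u v : nm (u - v) = nm (v - u).
Proof. by rewrite -nmN opprB. Qed.

Lemma nmD u v : nm (u + v) <= nm u + nm v.
Proof. by rewrite -lecR rmorphD /= -!nmE ler_normD. Qed.

Lemma nmZ (c : R[i]) v : nm (c *: v) = nm (c : R[i]^o) * nm v.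
Proof. by apply: (@complexI R); rewrite rmorphM /= -!nmE normrZ. Qed.

Lemma nearP (P : set V) :
  (\forall v \near (0 : V), P v) <-> exists2 e : R, 0 < e & forall v, nm v < e -> P v.
Proof.
split=> [/nbhs_norm0P[e /= e0 h]|[e e0 h]].
  exists (complex.Re e); move: e0; rewrite ltcE /= => /andP[/eqP i0 r0] //.
  move=> v vr; apply: h; rewrite /= nmE ltcE /= i0 eqxx //.
by apply/nbhs_norm0P; exists e%:C; rewrite /= ?ltcR // => v; rewrite /= lt_nm; exact: h.
Qed.

Lemma cvgnmP T (F : set_system T) {FF : Filter F} (f : T -> V) a :
  (f @ F --> a) <-> forall e : R, 0 < e -> \forall x \near F, nm (f x - a) < e.
Proof.
split=> [/cvgrPdist_lt h e e0|h].
  have := h e%:C; rewrite ltcR => /(_ e0); apply: filterS => x.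
  by rewrite lt_nm nmB.
apply/cvgrPdist_lt => e; rewrite ltcE /= => /andP[/eqP i0 r0].
apply: filterS (h _ r0) => x hx; rewrite nmE nmB ltcE /= i0 eqxx //.
Qed.
End Nm.

Lemma nmM (R : realType) (x y : R[i]^o) : nm (x * y) = nm x * nm y.
Proof. exact: nmZ. Qed.
Lemma nmC (R : realType) (x : R) : nm (x%:C : R[i]^o) = `|x|.
Proof. by rewrite /nm normc_def /= expr0n /= addr0 sqrtr_sqr. Qed.
Lemma nmi (R : realType) : nm ('i%C : R[i]^o) = 1.
Proof. by rewrite /nm normc_def /= expr0n expr1n /= add0r sqrtr1. Qed.

Lemma cvg0P (R : realType) (U V : normedModType R[i]) (f : U -> V) (a : V) :
  (f @ (0 : U) --> a) <-> forall e : R, 0 < e ->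
    exists2 d : R, 0 < d & forall h, nm h < d -> nm (f h - a) < e.
Proof.
by split=> [/cvgnmP h e /h/nearP|h]; last apply/cvgnmP => e /h/nearP.
Qed.

Section Cvg0.
Variables (R : realType) (U V : normedModType R[i]).
Implicit Types (f g : U -> V) (s : U -> R[i]^o).

Lemma cvg0D f g (a b : V) : f @ (0 : U) --> a -> g @ (0 : U) --> b ->
  (fun x => f x + g x) @ (0 : U) --> a + b.
Proof. by move=> fa gb; exact: cvgD. Qed.

Lemma cvg0B f g (a b : V) : f @ (0 : U) --> a -> g @ (0 : U) --> b ->
  (fun x => f x - g x) @ (0 : U) --> a - b.
Proof. by move=> fa gb; exact: cvgB. Qed.

Lemma cvg0Z s f (k : R[i]^o) (a : V) : s @ (0 : U) --> k -> f @ (0 : U) --> a ->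
  (fun x => (s x : R[i]) *: f x) @ (0 : U) --> (k : R[i]) *: a.
Proof. by move=> sk fa; exact: (cvgZ sk fa). Qed.

Lemma cvg0V s (k : R[i]^o) : k != 0 -> s @ (0 : U) --> k ->
  (fun x => (s x)^-1 : R[i]^o) @ (0 : U) --> (k^-1 : R[i]^o).
Proof. by move=> k0 sk; exact: (cvgV k0 sk). Qed.

Lemma cvg0_cst (a : V) : (fun _ : U => a) @ (0 : U) --> a.
Proof. exact: cvg_cst. Qed.
End Cvg0.
Arguments cvg0_cst {R} U {V} a.

(** * Goursat without integrals *)

(** Cousin's lemma for squares with corner (p, q) and side s: a failure on the unit square would
    descend through nested quarters and contradict the local hypothesis at their common point. *)
Lemma bisection (R : realType) (P : R -> R -> R -> Prop) :
  (forall p q s, 0 < s -> P p q (s / 2) -> P (p + s / 2) q (s / 2) ->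
     P p (q + s / 2) (s / 2) -> P (p + s / 2) (q + s / 2) (s / 2) -> P p q s) ->
  (forall x y, 0 <= x <= 1 -> 0 <= y <= 1 -> exists2 e, 0 < e &
     forall p q s, 0 < s < e -> p <= x <= p + s -> q <= y <= q + s -> P p q s) ->
  P 0 0 1.
Proof.
move=> Psplit Ploc; apply: contrapT => nP.
have /choice[next nextP] : forall t : R * R * R, exists t' : R * R * R,
    0 < t.2 -> ~ P t.1.1 t.1.2 t.2 ->
    [/\ t'.2 = t.2 / 2, t.1.1 <= t'.1.1 <= t.1.1 + t.2 / 2,
        t.1.2 <= t'.1.2 <= t.1.2 + t.2 / 2 & ~ P t'.1.1 t'.1.2 t'.2].
  case=> -[p q] s /=.
  have [s0|s0] := ltrP 0 s; last by exists (0, 0, 0).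
  have [n1|/contrapT n1] := pselect (~ P p q (s / 2)).
    by exists (p, q, s / 2) => _ _ /=; split=> //; apply/andP; split; lra.
  have [n2|/contrapT n2] := pselect (~ P (p + s / 2) q (s / 2)).
    by exists (p + s / 2, q, s / 2) => _ _ /=; split=> //; apply/andP; split; lra.
  have [n3|/contrapT n3] := pselect (~ P p (q + s / 2) (s / 2)).
    by exists (p, q + s / 2, s / 2) => _ _ /=; split=> //; apply/andP; split; lra.
  have [n4|/contrapT n4] := pselect (~ P (p + s / 2) (q + s / 2) (s / 2)).
    by exists (p + s / 2, q + s / 2, s / 2) => _ _ /=; split=> //; apply/andP; split; lra.
  by exists (p, q, s) => _ []; exact: Psplit.
pose u n := iter n next (0, 0, 1).
have uP n : (u n).2 = 2 ^- n /\ ~ P (u n).1.1 (u n).1.2 (u n).2.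
  elim: n => [|n [IH1 IH2]]; first by rewrite /= expr0 invr1.
  have := nextP (u n); rewrite IH1 => /(_ _ _)[||h1 _ _ h2].
  - by rewrite invr_gt0 exprn_gt0.
  - by rewrite -IH1.
  - by split=> //; rewrite [LHS]h1 exprSr invfM.
have s0 n : 0 < (u n).2 by rewrite (uP n).1 invr_gt0 exprn_gt0.
have uS n := nextP (u n) (s0 n) (uP n).2.
(* One coordinate at a time: lower ends increase, upper ends decrease, and the supremum of the lower
   ends lies in every interval. *)
have nested (c : R * R * R -> R) :
    (forall n, c (u n) <= c (u n.+1) <= c (u n) + (u n).2 / 2) -> c (u 0%N) = 0 ->
    exists2 x, 0 <= x <= 1 & forall n, c (u n) <= x <= c (u n) + (u n).2.
  move=> cS c0; pose v n := c (u n).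
  have vm n k : v n <= v (n + k)%N.
    elim: k => [|k IH]; first by rewrite addn0.
    by rewrite addnS; case/andP: (cS (n + k)%N) => h _; exact: le_trans h.
  have vM n k : v (n + k)%N + (u (n + k)%N).2 <= v n + (u n).2.
    elim: k => [|k IH]; first by rewrite addn0.
    apply: le_trans IH; rewrite addnS; case/andP: (cS (n + k)%N) => _ h.
    by have [-> _ _ _] := uS (n + k)%N; rewrite /v; lra.
  have vle n m : v m <= v n + (u n).2.
    have [/subnKC nm|/ltnW/subnKC mn] := leqP n m.
      by have := vM n (m - n)%N; have := s0 m; rewrite nm; lra.
    by have := vm m (n - m)%N; have := s0 n; rewrite mn; lra.
  have supv : has_sup (range v).
    split; first by exists (v 0%N), 0%N.
    by exists (v 0%N + (u 0%N).2) => _ [m _ <-].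
  have bnd n : v n <= sup (range v) <= v n + (u n).2.
    apply/andP; split; first by apply: sup_upper_bound => //; exists n.
    by apply: ge_sup; [exists (v 0%N), 0%N | move=> _ [m _ <-]].
  by exists (sup (range v)) => //; have := bnd 0%N; rewrite /v c0 /= add0r.
have [||x x01 xu] := nested (fun t => t.1.1) => [n|//|].
  by have [] := uS n.
have [||y y01 yu] := nested (fun t => t.1.2) => [n|//|].
  by have [] := uS n.
have [e e0 eP] := Ploc x y x01 y01.
have [n ne] : exists n, (u n).2 < e.
  exists (Num.truncn e^-1).+1; rewrite (uP _).1 invf_plt ?posrE ?exprn_gt0 //.
  apply: lt_trans (truncnS_gt _) _.
  by rewrite -natrX ltr_nat ltn_expl.
by apply: (uP n).2; apply: eP; rewrite ?s0 ?ne //.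
Qed.

Lemma leq_sum4 (n1 n2 n3 n4 n : nat) : (n1 + n2 + n3 + n4 <= n)%N ->
  [/\ (n1 <= n)%N, (n2 <= n)%N, (n3 <= n)%N & (n4 <= n)%N].
Proof. by move=> h; split; lia. Qed.

Section Goursat.
Variables (R : realType) (V : normedModType R[i]).
Local Notation C := (R[i]^o).
Implicit Types (f g : C -> V) (p v a d z h : C).

(** Caratheodory's form of complex differentiability: the slope [phi] is continuous at 0, so the
    rules for sums, products and inverses become statements about limits. *)
Definition cdiff f z := exists phi : C -> V,
  phi @ (0 : C) --> phi 0 /\ \forall h \near (0 : C), f (z + h) = f z + h *: phi h.

(** The midpoint rule on 2^n equal pieces, in place of a line integral. Midpoints make it exact on
    affine functions, and the recursion by halves matches the subdivision of parallelograms. *)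
Fixpoint seg_sum n f p v : V :=
  if n is m.+1 then seg_sum m f p (v / 2) + seg_sum m f (p + v / 2) (v / 2)
  else v *: f (p + v / 2).

(* The midpoint sum around the boundary of the parallelogram a + [0,1] d + [0,1] k. *)
Definition loop_sum n f a d k : V :=
  seg_sum n f a d + seg_sum n f (a + d) k - seg_sum n f (a + k) d - seg_sum n f a k.

Lemma seg_sum_affine n (al be : V) p v :
  seg_sum n (fun z => al + z *: be) p v = v *: (al + (p + v / 2) *: be).
Proof.
elim: n p v => [//|n IH] p v /=.
rewrite !IH !scalerDr !scalerA addrACA -(scalerDl al) -(scalerDl be).
by congr (_ *: _ + _ *: _); field.
Qed.

Lemma seg_sum_le n f g p v (M : R) :
  (forall t : R, 0 <= t <= 1 -> nm (f (p + v * t%:C) - g (p + v * t%:C)) <= M) ->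
  nm (seg_sum n f p v - seg_sum n g p v) <= nm v * M.
Proof.
elim: n p v => [|n IH] p v fg /=.
  rewrite -scalerBr nmZ; apply: (ler_wpM2l (nm_ge0 _)).
  have := fg 2^-1; rewrite rmorphV ?unitfE // rmorph_nat.
  by apply; apply/andP; split; lra.
have h2 : nm (v / 2 : C) = nm v / 2.
  have -> : v / 2 = v * (2^-1)%:C by rewrite rmorphV ?unitfE // rmorph_nat.
  by rewrite nmM nmC ger0_norm.
rewrite opprD addrACA; apply: le_trans (nmD _ _) _.
have -> : nm v * M = nm (v / 2 : C) * M + nm (v / 2 : C) * M by rewrite h2; field.
apply: lerD; apply: IH => t t01.
  have := fg (t / 2); rewrite rmorphM rmorphV ?unitfE // rmorph_nat /=.
  by rewrite [v * (_ / _)]mulrCA [t%:C * _]mulrC; apply; apply/andP; split; lra.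
have := fg ((1 + t) / 2); rewrite rmorphM rmorphD rmorphV ?unitfE // rmorph_nat /= rmorph1.
have -> : p + v * ((1 + t%:C) / 2) = p + v / 2 + v / 2 * t%:C by field.
by apply; apply/andP; split; lra.
Qed.

(** An exact identity, because half an edge carries a sum of one level less and each inner edge
    occurs twice with opposite signs. [glue] removes a common edge in direction [k], [glue2] one in
    direction [d]. *)
Lemma loop_sumS n f a d k : loop_sum n.+1 f a d k =
  loop_sum n f a (d / 2) (k / 2) + loop_sum n f (a + d / 2) (d / 2) (k / 2)
  + (loop_sum n f (a + k / 2) (d / 2) (k / 2)
  + loop_sum n f (a + d / 2 + k / 2) (d / 2) (k / 2)).
Proof.
rewrite /loop_sum /=.
have -> : a + d / 2 + d / 2 = a + d by field.
have -> : a + k / 2 + k / 2 = a + k by field.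
have -> : a + d / 2 + k / 2 + d / 2 = a + d + k / 2 by field.
have -> : a + d / 2 + k / 2 + k / 2 = a + k + d / 2 by field.
rewrite [a + k / 2 + d / 2]addrAC.
have glue (x1 x2 x3 x4 y1 y2 y3 : V) :
    (x1 + x2 - x3 - x4) + (y1 + y2 - y3 - x2) = (x1 + y1) + y2 - (x3 + y3) - x4.
  rewrite !opprD !addrA.
  by rewrite [LHS](ACl ((1 * 5 * 6 * 3 * 7 * 4) * (2 * 8))) /= subrr addr0.
have glue2 (x1 x2 x3 x4 y2 y3 y4 : V) :
    (x1 + x2 - x3 - x4) + (x3 + y2 - y3 - y4) = x1 + (x2 + y2) - y3 - (x4 + y4).
  rewrite !opprD !addrA.
  by rewrite [LHS](ACl ((1 * 2 * 6 * 7 * 4 * 8) * (5 * 3))) /= subrr addr0.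
by rewrite !glue glue2.
Qed.

Lemma loop_sum_affine n (al be : V) a d k :
  loop_sum n (fun z => al + z *: be) a d k = 0.
Proof.
rewrite /loop_sum !seg_sum_affine !scalerDr !scalerA.
rewrite !opprD !addrA [LHS](ACl (1 * 5 * (3 * 7) * (2 * 4 * 6 * 8))) /=.
rewrite !subrr !add0r -!(scaleNr _ be) -!(scalerDl be).
by apply/eqP; rewrite scaler_eq0; apply/orP; left; apply/eqP; field.
Qed.

Lemma loop_sum_le n f g (a d k : C) (M : R) :
  (forall p q : R, 0 <= p <= 1 -> 0 <= q <= 1 ->
    nm (f (a + d * p%:C + k * q%:C) - g (a + d * p%:C + k * q%:C)) <= M) ->
  nm (loop_sum n f a d k - loop_sum n g a d k) <= 2 * (nm d + nm k) * M.
Proof.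
move=> fg; rewrite /loop_sum.
have e1 : nm (seg_sum n f a d - seg_sum n g a d) <= nm d * M.
  apply: seg_sum_le => t t01; have := fg t 0 t01.
  by rewrite rmorph0 mulr0 addr0; apply; rewrite lexx ler01.
have e2 : nm (seg_sum n f (a + d) k - seg_sum n g (a + d) k) <= nm k * M.
  apply: seg_sum_le => t t01; have := fg 1 t _ t01.
  by rewrite rmorph1 mulr1; apply; rewrite lexx ler01.
have e3 : nm (seg_sum n f (a + k) d - seg_sum n g (a + k) d) <= nm d * M.
  apply: seg_sum_le => t t01; have := fg t 1 t01.
  by rewrite rmorph1 mulr1 addrAC; apply; rewrite lexx ler01.
have e4 : nm (seg_sum n f a k - seg_sum n g a k) <= nm k * M.
  apply: seg_sum_le => t t01; have := fg 0 t _ t01.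
  by rewrite rmorph0 mulr0 addr0; apply; rewrite lexx ler01.
have -> (x1 x2 x3 x4 y1 y2 y3 y4 : V) : x1 + x2 - x3 - x4 - (y1 + y2 - y3 - y4) =
    ((x1 - y1) + (x2 - y2)) + (- (x3 - y3) + - (x4 - y4)).
  by rewrite !opprD !addrA !opprK [LHS](ACl (1 * 5 * 2 * 6 * 3 * 7 * 4 * 8)).
rewrite -nmN in e3; rewrite -nmN in e4.
apply: le_trans (nmD _ _) _; apply: le_trans (lerD (nmD _ _) (nmD _ _)) _.
have -> : 2 * (nm d + nm k) * M = (nm d * M + nm k * M) + (nm d * M + nm k * M) by ring.
by rewrite !lerD.
Qed.

Lemma goursat f (a d k : C) :
  (forall p q : R, 0 <= p <= 1 -> 0 <= q <= 1 -> cdiff f (a + d * p%:C + k * q%:C)) ->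
  forall e : R, 0 < e -> exists N, forall n, (N <= n)%N -> nm (loop_sum n f a d k) <= e.
Proof.
move=> fd e e0.
(* The tolerance is proportional to the area: four quarters with e (s/2)^2 each add up to e s^2. The
   threshold [N] may depend on the square. *)
pose P (p q s : R) := exists N, forall n, (N <= n)%N ->
  nm (loop_sum n f (a + d * p%:C + k * q%:C) (d * s%:C) (k * s%:C)) <= e * s ^+ 2.
suff [N hN] : P 0 0 1.
  exists N => n /hN.
  by rewrite !(rmorph0, rmorph1) !mulr0 !addr0 !mulr1 expr1n mulr1.
have C2 (s : R) : (s / 2)%:C = s%:C / 2 by rewrite rmorphM rmorphV ?unitfE // rmorph_nat.
apply: bisection => [p q s s0 [N1 h1] [N2 h2] [N3 h3] [N4 h4]|x y x01 y01].
  (* The sum dominates all four thresholds; the successor pays for the level lost in the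
     subdivision. *)
  exists (N1 + N2 + N3 + N4).+1; case=> // n hn; rewrite loop_sumS.
  have [/h1{}h1 /h2{}h2 /h3{}h3 /h4{}h4] := leq_sum4 hn.
  have e2 : a + d * (p + s / 2)%:C + k * q%:C = a + d * p%:C + k * q%:C + d * s%:C / 2.
    by rewrite rmorphD /= C2; ring.
  have e3 : a + d * p%:C + k * (q + s / 2)%:C = a + d * p%:C + k * q%:C + k * s%:C / 2.
    by rewrite rmorphD /= C2; ring.
  have e4 : a + d * (p + s / 2)%:C + k * (q + s / 2)%:C =
     a + d * p%:C + k * q%:C + d * s%:C / 2 + k * s%:C / 2.
    by rewrite !rmorphD /= C2; ring.
  rewrite !C2 !mulrA in h1; rewrite e2 !C2 !mulrA in h2.
  rewrite e3 !C2 !mulrA in h3; rewrite e4 !C2 !mulrA in h4.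
  have -> : e * s ^+ 2 = 4 * (e * (s / 2) ^+ 2) by field.
  apply: le_trans (nmD _ _) _.
  apply: le_trans (lerD (nmD _ _) (nmD _ _)) _.
  lra.
have [phi [phi0 fphi]] := fd x y x01 y01.
set z := a + _ + _ in fphi.
pose D := nm d + nm k; have D0 : 0 <= D by rewrite addr_ge0 ?nm_ge0.
(* On a parameter square of side s containing (x, y), the error against the tangent map is at most
   e1 s D and the perimeter is 2 s D, so the loop sum is at most 2 D^2 e1 s^2. The added 1 covers D
   = 0. *)
pose e1 := e / (2 * D ^+ 2 + 1).
have D1 : 0 < 2 * D ^+ 2 + 1 by rewrite ltr_wpDl ?mulr_ge0 ?sqr_ge0.
have e10 : 0 < e1 by rewrite divr_gt0.
have /cvgnmP/(_ _ e10)/(filterI fphi)/nearP[dl dl0 hdl] := phi0.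
exists (dl / (D + 1)) => [|p q s /andP[s0 sdl] /andP[px xp] /andP[qy yq]].
  by rewrite divr_gt0 // ltr_wpDl.
exists 0%N => n _.
(* The tangent map at z. Its loop sums vanish exactly, which takes the place of a primitive. *)
pose g w := (f z - z *: phi 0) + w *: phi 0.
have sD : s * (D + 1) < dl by rewrite -ltr_pdivlMr // ltr_wpDl.
have := @loop_sum_le n f g (a + d * p%:C + k * q%:C) (d * s%:C) (k * s%:C) (e1 * (s * D)).
rewrite loop_sum_affine subr0 !nmM !nmC (gtr0_norm s0) => h.
apply: le_trans (h _) _; last first.
  rewrite -mulrDl -/D.
  have -> : 2 * (D * s) * (e1 * (s * D)) = (2 * D ^+ 2) * e1 * s ^+ 2 by ring.
  apply: ler_wpM2r; first exact: sqr_ge0.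
  have -> : 2 * D ^+ 2 * e1 = e - e1 by rewrite /e1; field; exact: lt0r_neq0.
  lra.
move=> t1 t2 /andP[t10 t11] /andP[t20 t21].
set w := _ + k * s%:C * _.
have wz : w - z = d * (p + s * t1 - x)%:C + k * (q + s * t2 - y)%:C.
  by rewrite /w /z !rmorphB !rmorphD !rmorphM /=; ring.
have nwz : nm (w - z) <= s * D.
  rewrite wz /D mulrDr; apply: le_trans (nmD _ _) _; rewrite !nmM !nmC.
  apply: lerD; rewrite mulrC; apply: ler_wpM2r; rewrite ?nm_ge0 // ler_norml.
    by apply/andP; split; nra.
  by apply/andP; split; nra.
have [|h1 /ltW h2] := hdl (w - z).
  by apply: le_lt_trans nwz _; apply: le_lt_trans sD; rewrite ler_pM2l // lerDl.
move: h1; rewrite /= addrC subrK => ->.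
have -> : f z + (w - z) *: phi (w - z) - g w = (w - z) *: (phi (w - z) - phi 0).
  rewrite /g scalerBr [(w - z) *: phi 0]scalerBl !opprD !opprK.
  rewrite !addrA [LHS](ACl (2 * 5 * 4 * (1 * 3))) /= subrr addr0.
  by rewrite -addrA [- _ + _]addrC.
rewrite nmZ mulrC; apply: ler_pM => //; exact: nm_ge0.
Qed.
End Goursat.

(** * Cauchy's formula at the centre, for functions vanishing on an annulus *)

Section Annulus.
Variables (R : realType) (V : normedModType R[i]).
Local Notation C := (R[i]^o).
Implicit Types (f g u : C -> V) (p v a d z h : C).

Lemma cartesianE (x y : R) : x +i* y = x%:C + 'i%C * y%:C.
Proof. by rewrite [LHS]complexE. Qed.

Lemma cdiff_subr u (b : V) z : cdiff u z -> cdiff (fun w => u w - b) z.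
Proof.
move=> [phi [phi0 hphi]]; exists phi; split=> //.
by apply: filterS hphi => h ->; rewrite addrAC.
Qed.

Lemma cdiff_inv_scale u z : z != 0 -> cdiff u z -> cdiff (fun w => w^-1 *: u w) z.
Proof.
move=> z0 [phi [phi0 hphi]].
have zh : (fun h : C => z + h) @ (0 : C) --> z.
  apply/cvg0P => e e0; exists e => // h.
  by rewrite addrAC subrr add0r.
have zhV : (fun h : C => (z + h)^-1) @ (0 : C) --> z^-1.
  exact: cvg0V z0 zh.
exists (fun h => (z + h)^-1 *: phi h - (z + h)^-1 *: (z^-1 *: u z)); split.
  rewrite addr0; exact: (cvg0B (cvg0Z zhV phi0) (cvg0Z zhV (cvg0_cst C (z^-1 *: u z)))).
have zn0 : \forall h \near (0 : C), z + h != 0.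
  have /cvg0P/(_ (nm z)) := zh; case=> [|e e0 he].
    rewrite lt_neqAle nm_ge0 andbT; apply/eqP => /esym/nm_eq0 zz.
    by rewrite zz eqxx in z0.
  apply/nearP; exists e => // h /he /=; apply: contraTneq => ->.
  by rewrite sub0r nmN ltxx.
near=> h.
have hn0 : z + h != 0 by near: h.
have -> : u (z + h) = u z + h *: phi h by near: h.
rewrite scalerBr !scalerA scalerDr scalerA addrA [RHS]addrAC; congr (_ + _).
  rewrite -scalerBl; congr (_ *: _); field.
  by rewrite hn0 z0.
by rewrite [h * _]mulrC.
Unshelve. all: by end_near.
Qed.

Lemma seg_sum_eq n f g p v :
  (forall t : R, 0 <= t <= 1 -> f (p + v * t%:C) = g (p + v * t%:C)) ->
  seg_sum n f p v = seg_sum n g p v.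
Proof.
move=> fg; apply/eqP; rewrite -subr_eq0; apply/eqP/nm_eq0/eqP.
rewrite eq_le nm_ge0 andbT -(mulr0 (nm v)); apply: seg_sum_le => t t01.
by rewrite fg // subrr nm0.
Qed.

Lemma seg_sumZ n (w : C -> C) (b : V) p v :
  seg_sum n (fun z => w z *: b) p v = (seg_sum n w p v : C) *: b.
Proof.
by elim: n p v => [|n IH] p v /=; rewrite ?IH ?scalerA // -scalerDl.
Qed.

Lemma seg_sum0 n p v : seg_sum n (fun _ => 0) p v = 0 :> V.
Proof. by elim: n p v => [|n IH] p v /=; rewrite ?IH ?scaler0 // addr0. Qed.

(** A pointwise bound survives each halving, since [v] and [m] are halved together. [s] serves as a
    sign, so one induction covers bounds from below and from above. *)
Lemma Im_seg_sum_ge n (w : C -> C) p v (s m : R) :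
  (forall t : R, 0 <= t <= 1 -> m <= s * complex.Im (v * w (p + v * t%:C))) ->
  m <= s * complex.Im (seg_sum n w p v).
Proof.
have C2 : (2^-1 : C) = (2^-1)%:C by rewrite rmorphV ?unitfE // rmorph_nat.
have ImZ (r : R) (x : C) : complex.Im (x * r%:C) = complex.Im x * r.
  by case: x => x y /=; ring.
elim: n p v m => [|n IH] p v m hm /=.
  by have := hm 2^-1; rewrite -C2; apply; apply/andP; split; lra.
have -> (x y : C) : complex.Im (x + y) = complex.Im x + complex.Im y.
  by case: x y => [? ?] [].
have h2 (t : R) : (t / 2)%:C = t%:C / 2 by rewrite rmorphM rmorphV ?unitfE // rmorph_nat.
have key p' (t' : R -> R) : (forall t, 0 <= t <= 1 -> 0 <= t' t <= 1) ->
   (forall t, p' + v / 2 * t%:C = p + v * (t' t)%:C) ->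
    m / 2 <= s * complex.Im (seg_sum n w p' (v / 2)).
  move=> ht' pt'; apply: IH => t /ht'/hm; rewrite -pt'.
  have -> : v / 2 * w (p' + v / 2 * t%:C) = v * w (p' + v / 2 * t%:C) * (2^-1)%:C.
    by rewrite -C2 mulrAC.
  by rewrite ImZ mulrA; lra.
rewrite mulrDr; have := key p (fun t => t / 2); have := key (p + v / 2) (fun t => (1 + t) / 2).
move=> h3 h4; rewrite [m]splitr; apply: lerD.
  apply: h4 => t; first by move=> /andP[? ?]; apply/andP; split; lra.
  by rewrite h2; ring.
apply: h3 => t; first by move=> /andP[? ?]; apply/andP; split; lra.
by rewrite h2 rmorphD rmorph1; ring.
Qed.

(** Controls the quotient at its singular point, where Goursat's argument does not apply. At z = 0
    itself the quotient is 0. *)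
Lemma cdiff_bounded_quot u : cdiff u 0 -> exists e K : R,
  [/\ 0 < e, 0 < K & forall z, nm z < e -> nm (z^-1 *: (u z - u 0)) <= K].
Proof.
move=> [phi [/cvgnmP/(_ _ ltr01)/filterI phi0 /phi0/nearP[e e0 he]]].
exists e, (nm (phi 0) + 1); split=> // [|z /he[h1]].
  by rewrite ltr_wpDl ?nm_ge0.
rewrite /= add0r => ->.
rewrite addrAC subrr add0r; have [->|z0] := eqVneq z 0.
  by rewrite scale0r scaler0 nm0 addr_ge0 ?nm_ge0.
rewrite scalerA mulVf // scale1r; have := nmD (phi 0) (phi z - phi 0).
by rewrite addrC subrK; lra.
Qed.

(** The square has a corner at the singularity 0. After halving, three quarters avoid 0 and fall
    under [goursat]; repeating this makes the corner square so small that boundedness of the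
    quotient suffices. *)
Lemma loop_sum_quot u d : d != 0 ->
  (forall z, nm z <= 2 * nm d -> cdiff u z) ->
  forall e : R, 0 < e -> exists N, forall n, (N <= n)%N ->
    nm (loop_sum n (fun z => z^-1 *: (u z - u 0)) 0 d ('i%C * d)) <= e.
Proof.
set g := fun z => _; move=> d0 ud e e0.
have nd0 : 0 < nm d.
  by rewrite lt_neqAle nm_ge0 andbT; apply/eqP => /esym/nm_eq0/eqP; apply/negP.
have nm2 (z : C) : nm (z / 2 : C) = nm z / 2.
  have -> : z / 2 = z * (2^-1)%:C by rewrite rmorphV ?unitfE // rmorph_nat.
  by rewrite nmM nmC ger0_norm.
have [eta [K [eta0 K0 hK]]] : exists e K : R,
    [/\ 0 < e, 0 < K & forall z, nm z < e -> nm (g z) <= K].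
  by apply: cdiff_bounded_quot; apply: ud; rewrite nm0 mulr_ge0 // ltW.
have nmpt (z : C) (p q : R) : 0 <= p <= 1 -> 0 <= q <= 1 ->
    nm (z * p%:C + 'i%C * z * q%:C) <= 2 * nm z.
  move=> /andP[p0 p1] /andP[q0 q1]; apply: le_trans (nmD _ _) _.
  by rewrite !nmM !nmC nmi !ger0_norm //; have := nm_ge0 z; nra.
(* Points of the square are within 2 |d| of 0, so eta / 4 keeps them where the bound [K] holds; e /
   (8 K) makes [K] times the perimeter 4 |d| at most e / 2. *)
pose dl := Num.min (eta / 4) (e / (8 * K)).
have dl0 : 0 < dl by rewrite lt_min !divr_gt0 // mulr_gt0.
(* The number m of halvings is fixed in advance, so finitely many thresholds occur. e / 2 is
   reserved for the last corner square, while e' is shared in four parts at each halving. *)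
suff claim m : forall d, d != 0 -> (forall z, nm z <= 2 * nm d -> cdiff u z) ->
    nm d <= dl * 2 ^+ m -> forall e' : R, 0 < e' -> exists N, forall n, (N <= n)%N ->
    nm (loop_sum n g 0 d ('i%C * d)) <= e / 2 + e'.
  have [||N hN] := claim (Num.truncn (nm d / dl)).+1 d d0 ud _ (e / 2) _.
  - rewrite mulrC -ler_pdivrMr //; apply/ltW; apply: lt_trans (truncnS_gt _) _.
    by rewrite -natrX ltr_nat ltn_expl.
  - by rewrite divr_gt0.
  by exists N => n /hN; lra.
elim: m => [|m IH] {nd0} {}d {}d0 {}ud.
  rewrite expr0 mulr1 le_min => /andP[d1 d2] e' e'0; exists 0%N => n _.
  have := @loop_sum_le _ _ n g (fun _ => 0) 0 d ('i%C * d) K.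
  rewrite /loop_sum !seg_sum0 !(subr0, addr0) nmM nmi mul1r => h.
  apply: le_trans (h _) _.
    move=> p q p01 q01; rewrite subr0; apply: hK; rewrite add0r.
    by apply: le_lt_trans (nmpt _ _ _ p01 q01) _; lra.
  move: d2; rewrite ler_pdivlMr ?mulr_gt0 //; lra.
move=> dm e' e'0.
have e4 : 0 < e' / 4 by rewrite divr_gt0.
have [|||N1 h1] := IH (d / 2) _ _ _ _ e4.
- by rewrite mulf_neq0 // invr_eq0.
- by move=> z; rewrite nm2 => hz; apply: ud; have := nm_ge0 d; lra.
- by rewrite nm2; move: dm; rewrite exprSr; lra.
(* In units of d / 2 the quarter starts at p0 + i q0; p0 + q0 > 0 keeps all its points away from
   0. *)
have gd a (p0 q0 : R) : 0 <= p0 <= 1 -> 0 <= q0 <= 1 -> 0 < p0 + q0 ->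
    a = d / 2 * p0%:C + 'i%C * d / 2 * q0%:C ->
    exists N, forall n, (N <= n)%N ->
    nm (loop_sum n g a (d / 2) ('i%C * d / 2)) <= e' / 4.
  move=> /andP[p00 p01] /andP[q00 q01] pq0 ->; apply: goursat => // p q /andP[p0' p1] /andP[q0' q1].
  set z := _ + _.
  have zE : z = d / 2 * ((p0 + p) +i* (q0 + q)).
    rewrite /z (cartesianE (_ + _)) !rmorphD /=; ring.
  apply: cdiff_inv_scale; last apply: cdiff_subr; last apply: ud.
    rewrite zE !mulf_neq0 ?invr_eq0 // eq_complex /= negb_and.
    have [p00'|] := eqVneq (p0 + p) 0; rewrite //=.
    by apply/eqP; lra.
  have := nmpt d ((p0 + p) / 2) ((q0 + q) / 2).
  have -> : d * ((p0 + p) / 2)%:C + 'i%C * d * ((q0 + q) / 2)%:C = z.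
    rewrite zE (cartesianE (_ + _)) !rmorphM !rmorphD rmorphV ?unitfE // rmorph_nat /=; ring.
  by apply; apply/andP; split; lra.
have b01 : (0 : R) <= (0 : R) <= (1 : R) by apply/andP; split; lra.
have b11 : (0 : R) <= (1 : R) <= (1 : R) by apply/andP; split; lra.
have [||N2 h2] := gd (d / 2) 1 0 b11 b01.
- by rewrite addr0.
- by rewrite rmorph1 rmorph0 mulr1 mulr0 addr0.
have [||N3 h3] := gd ('i%C * d / 2) 0 1 b01 b11.
- by rewrite add0r.
- by rewrite rmorph1 rmorph0 mulr1 mulr0 add0r.
have [||N4 h4] := gd (d / 2 + 'i%C * d / 2) 1 1 b11 b11.
- by rewrite addr_gt0.
- by rewrite rmorph1 !mulr1.
exists (N1 + N2 + N3 + N4).+1; case=> // n hn; rewrite loop_sumS !add0r.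
have [/h1{}h1 /h2{}h2 /h3{}h3 /h4{}h4] := leq_sum4 hn.
rewrite mulrA in h1.
apply: le_trans (nmD _ _) _; apply: le_trans (lerD (nmD _ _) (nmD _ _)) _.
lra.
Qed.

(** A quarter turn about 0 along two outer edges of a square. The integral would be i pi / 2; the
    bound 1 comes from 1 / (1 + t^2) >= 1 / 2 on each edge. *)
Lemma Im_loop_inv n (d : C) : d != 0 ->
  1 <= complex.Im (seg_sum n (fun z : C => z^-1 : C) d ('i%C * d)
                   - seg_sum n (fun z : C => z^-1 : C) ('i%C * d) d : C).
Proof.
move=> d0.
have e1 : 2^-1 <= 1 * complex.Im (seg_sum n (fun z : C => z^-1 : C) d ('i%C * d)).
  apply: Im_seg_sum_ge => t /andP[t0 t1].
  have -> : 'i%C * d * (d + 'i%C * d * t%:C)^-1 = 'i%C * (1 +i* t)^-1.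
    have -> : d + 'i%C * d * t%:C = d * (1 +i* t).
      by rewrite (cartesianE 1 t) rmorph1; ring.
    by rewrite invfM mulrA mulfK.
  have t2 : 0 < 1 + t ^+ 2 by rewrite ltr_wpDr ?sqr_ge0.
  have -> : complex.Im ('i%C * (1 +i* t)^-1) = (1 + t ^+ 2)^-1.
    by rewrite /= expr1n; field; rewrite lt0r_neq0.
  by rewrite mul1r lef_pV2 ?posrE //; nra.
have e2 : 2^-1 <= -1 * complex.Im (seg_sum n (fun z : C => z^-1 : C) ('i%C * d) d).
  apply: Im_seg_sum_ge => t /andP[t0 t1].
  have -> : d * ('i%C * d + d * t%:C)^-1 = (t +i* 1)^-1.
    have -> : 'i%C * d + d * t%:C = d * (t +i* 1).
      by rewrite (cartesianE t) rmorph1; ring.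
    by rewrite invfM mulrA mulfV // mul1r.
  have t2 : 0 < 1 + t ^+ 2 by rewrite ltr_wpDr ?sqr_ge0.
  have -> : complex.Im (t +i* 1)^-1 = - (1 + t ^+ 2)^-1.
    by rewrite /= expr1n; field; rewrite lt0r_neq0 //= addrC lt0r_neq0.
  by rewrite mulrNN mul1r lef_pV2 ?posrE //; nra.
move: e1 e2; move: (seg_sum _ _ _ _) (seg_sum _ _ _ _) => [x1 y1] [x2 y2] /=; lra.
Qed.

(** Squares with a corner at 0 and sides d, i d, for d = c, i c, -c, -i c, tile a square about 0.
    The edges at 0 cancel; on the outer edges [u] vanishes and the quotient is - u 0 / z. The total
    winding has imaginary part at least 4 and the four loops cost at most 4 e, whence |u 0| <= e. *)
Lemma cdiff_eq0 u (c : R) : 0 < c -> (forall z, nm z <= 2 * c -> cdiff u z) ->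
  (forall z, c <= nm z <= 2 * c -> u z = 0) -> u 0 = 0.
Proof.
move=> c0 ud u0; apply: nm_eq0; apply/eqP; rewrite eq_le nm_ge0 andbT.
apply/ler_addgt0Pr => e e0; rewrite add0r.
pose g z : V := z^-1 *: (u z - u 0).
pose w (z : C) : C := z^-1.
pose K n (d : C) : C := seg_sum n w d ('i%C * d) - seg_sum n w ('i%C * d) d.
have loopE n d : nm d = c -> loop_sum n g 0 d ('i%C * d) =
    seg_sum n g 0 d - seg_sum n g 0 ('i%C * d) - K n d *: u 0.
  move=> dc; rewrite /loop_sum !add0r.
  have out p v : (forall t : R, 0 <= t <= 1 -> c <= nm (p + v * t%:C : C) <= 2 * c) ->
      seg_sum n g p v = - ((seg_sum n w p v : C) *: u 0).
    move=> hp; rewrite -scalerN -seg_sumZ; apply: seg_sum_eq => t /hp/u0.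
    by rewrite /g => ->; rewrite sub0r.
  (* Points of the outer edges are d q with |q|^2 = 1 + t^2 between 1 and 2, so they stay in the
     annulus. *)
  have bd (q : C) (t : R) : nm q ^+ 2 = 1 + t ^+ 2 -> 0 <= t <= 1 -> c <= nm (d * q) <= 2 * c.
    move=> q2 /andP[t0 t1]; rewrite nmM dc; have := nm_ge0 q => q0.
    have : 1 <= nm q <= 2 by apply/andP; split; nra.
    by move=> /andP[? ?]; apply/andP; split; nra.
  have nm2 (q : C) : nm q ^+ 2 = complex.Re q ^+ 2 + complex.Im q ^+ 2.
    by rewrite /nm normc_def /= sqr_sqrtr // addr_ge0 ?sqr_ge0.
  have h1 t : 0 <= t <= 1 -> c <= nm (d + 'i%C * d * t%:C : C) <= 2 * c.
    move=> t01; have -> : d + 'i%C * d * t%:C = d * (1 +i* t).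
      by rewrite (cartesianE 1 t) rmorph1; ring.
    by apply: bd t01; rewrite nm2 /= expr1n.
  have h2 t : 0 <= t <= 1 -> c <= nm ('i%C * d + d * t%:C : C) <= 2 * c.
    move=> t01; have -> : 'i%C * d + d * t%:C = d * (t +i* 1).
      by rewrite (cartesianE t) rmorph1; ring.
    by apply: bd t01; rewrite nm2 /= expr1n addrC.
  by rewrite (out _ _ h1) (out _ _ h2) /K scalerBl !opprB opprK !addrA [LHS](ACl (1 * 4 * 3 * 2)).
pose cc : C := c%:C.
have ncc : nm cc = c by rewrite nmC gtr0_norm.
have ni (d : C) : nm ('i%C * d : C) = nm d by rewrite nmM nmi mul1r.
have lim d : nm d = c -> exists N, forall n, (N <= n)%N ->
    nm (loop_sum n g 0 d ('i%C * d)) <= e.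
  move=> dc; apply: loop_sum_quot => //; last by rewrite dc.
  by apply/eqP => d0; move: dc; rewrite d0 nm0; lra.
have [N0 h0] := lim cc ncc.
have [|N1 h1] := lim ('i%C * cc); first by rewrite ni.
have [|N2 h2] := lim ('i%C * ('i%C * cc)); first by rewrite !ni.
have [|N3 h3] := lim ('i%C * ('i%C * ('i%C * cc))); first by rewrite !ni.
pose n := (N0 + N1 + N2 + N3)%N.
have [/h0{}h0 /h1{}h1 /h2{}h2 /h3{}h3] := leq_sum4 (leqnn n).
move: h0 h1 h2 h3; rewrite !loopE ?ni //.
have i4 : 'i%C * ('i%C * ('i%C * ('i%C * cc))) = cc.
  have ii (z : C) : 'i%C * ('i%C * z) = - z by rewrite mulrA -expr2 sqr_i mulN1r.
  by rewrite !ii opprK.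
rewrite i4.
set d1 := 'i%C * cc; set d2 := 'i%C * d1; set d3 := 'i%C * d2.
set s0 := seg_sum n g 0 cc; set s1 := seg_sum n g 0 d1.
set s2 := seg_sum n g 0 d2; set s3 := seg_sum n g 0 d3 => h0 h1 h2 h3.
pose KK : C := K n cc + K n d1 + (K n d2 + K n d3).
have hK : nm (KK *: u 0) <= 4 * e.
  rewrite -nmN.
  have telescope (k0 k1 k2 k3 : C) (a0 a1 a2 a3 b : V) :
      - ((k0 + k1 + (k2 + k3)) *: b) = (a0 - a1 - k0 *: b) + (a1 - a2 - k1 *: b)
      + ((a2 - a3 - k2 *: b) + (a3 - a0 - k3 *: b)).
    rewrite !scalerDl !opprD !addrA.
    rewrite [RHS](ACl ((3 * 6 * 9 * 12) * (1 * 11) * (2 * 4) * (5 * 7) * (8 * 10))) /=.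
    by rewrite subrr !addNr !addr0.
  rewrite (telescope _ _ _ _ s0 s1 s2 s3).
  apply: le_trans (nmD _ _) _; apply: le_trans (lerD (nmD _ _) (nmD _ _)) _; lra.
have nz (d : C) : nm d = c -> d != 0.
  by move=> dc; apply/eqP => d0; move: dc; rewrite d0 nm0; lra.
have I0 : 1 <= complex.Im (K n cc) by apply: Im_loop_inv; exact: nz.
have I1 : 1 <= complex.Im (K n d1) by apply: Im_loop_inv; apply: nz; rewrite !ni.
have I2 : 1 <= complex.Im (K n d2) by apply: Im_loop_inv; apply: nz; rewrite !ni.
have I3 : 1 <= complex.Im (K n d3) by apply: Im_loop_inv; apply: nz; rewrite !ni.
have K4 : 4 <= nm KK.
  have : complex.Im KK <= nm KK.
    rewrite /nm normc_def /=; apply: le_trans (ler_norm _) _.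
    by rewrite -sqrtr_sqr ler_wsqrtr // lerDr sqr_ge0.
  apply: le_trans; rewrite /KK; move: I0 I1 I2 I3.
  by case: (K n cc) (K n d1) (K n d2) (K n d3) => [? ?] [? ?] [? ?] [? ?] /=; lra.
by move: hK; rewrite nmZ; have := nm_ge0 (u 0); nra.
Qed.
End Annulus.

(** * Banach algebras *)

Lemma geometric_small (R : realType) (c r e : R) : 0 <= r < 1 -> 0 < e ->
  exists n, c * r ^+ n < e.
Proof.
move=> /andP[r0 r1] e0; have : (fun n => c * r ^+ n) @ \oo --> c * 0.
  by apply: cvgM; [exact: cvg_cst | apply: cvg_expr; rewrite ger0_norm].
rewrite mulr0 => /cvgrPdist_lt/(_ _ e0)[N _ hN]; exists N.
have := hN N (leqnn N); rewrite /= sub0r normrN; apply: le_lt_trans; exact: ler_norm.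
Qed.

Lemma geometric_cvg (R : realType) (V : completeNormedModType R[i]) (u : nat -> V) (c r : R) :
  0 <= r < 1 -> (forall n, nm (u n.+1 - u n) <= c * r ^+ n) ->
  exists l, forall n, nm (l - u n) <= c / (1 - r) * r ^+ n.
Proof.
move=> r01 hu; have /andP[r0 r1] := r01.
have c0 : 0 <= c by have := hu 0%N; rewrite expr0 mulr1; apply: le_trans; exact: nm_ge0.
have r10 : 0 < 1 - r by lra.
have dist n k : nm (u (n + k)%N - u n) <= c / (1 - r) * r ^+ n.
  suff : nm (u (n + k)%N - u n) <= c / (1 - r) * (r ^+ n * (1 - r ^+ k)).
    move=> /le_trans; apply; apply: ler_wpM2l; first by rewrite divr_ge0 // ltW.
    by rewrite ler_piMr ?exprn_ge0 // lerBlDr lerDl exprn_ge0.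
  elim: k => [|k IH]; first by rewrite addn0 subrr nm0 expr0 subrr !mulr0.
  have -> : u (n + k.+1)%N - u n = (u (n + k).+1 - u (n + k)%N) + (u (n + k)%N - u n).
    by rewrite addrA subrK addnS.
  apply: le_trans (nmD _ _) _; apply: le_trans (lerD (hu _) IH) _.
  rewrite exprD exprS.
  have -> : c * (r ^+ n * r ^+ k) + c / (1 - r) * (r ^+ n * (1 - r ^+ k))
     = c / (1 - r) * (r ^+ n * (1 - r * r ^+ k)) by field; exact: lt0r_neq0.
  by [].
have cu : cvg (u @ \oo).
  apply: cauchy_cvg; apply: cauchy_exP => e; rewrite ltcE /= => /andP[/eqP i0 e0].
  have [N hN] := geometric_small (c / (1 - r)) r01 e0.
  exists (u N); exists N => // n /= /subnKC <-.
  rewrite -ball_normE /ball_ /= nmE nmB ltcE /= i0 eqxx /=.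
  exact: le_lt_trans (dist _ _) hN.
exists (lim (u @ \oo)) => n; apply/ler_addgt0Pr => e e0.
have /cvgnmP/(_ _ e0)[N _ hN] := cu.
have := hN (n + N)%N (leq_addl _ _) => /= h1.
rewrite -(subrK (u (n + N)%N) (lim _)) -addrA; apply: le_trans (nmD _ _) _.
by rewrite [leRHS]addrC; apply: lerD; [rewrite nmB ltW | exact: dist].
Qed.

Section BanachAlg.
Variables (R : realType) (A : completeNormedModType R[i]) (m : banach_alg A).
Local Notation "x ** y" := (bmul m x y) (at level 40, left associativity).
Local Notation one := (bone m).
Implicit Types (x y z w a b c : A).

Lemma bmulZ1l (k : R[i]) x : (k *: one) ** x = k *: x.
Proof. by rewrite bmulZl bmul1l. Qed.

Lemma bmul0l x : 0 ** x = 0.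
Proof. by rewrite -[X in X ** _](scale0r x) bmulZl scale0r. Qed.

Lemma bmul0r x : x ** 0 = 0.
Proof. by rewrite -[X in _ ** X](scale0r x) bmulZr scale0r. Qed.

Lemma bmulNl x y : (- x) ** y = - (x ** y).
Proof. by rewrite -scaleN1r bmulZl scaleN1r. Qed.

Lemma bmulNr x y : x ** (- y) = - (x ** y).
Proof. by rewrite -scaleN1r bmulZr scaleN1r. Qed.

Lemma bmulBl x y z : (x - y) ** z = x ** z - y ** z.
Proof. by rewrite bmulDl bmulNl. Qed.

Lemma bmulBr x y z : x ** (y - z) = x ** y - x ** z.
Proof. by rewrite bmulDr bmulNr. Qed.

Lemma nm_bmul x y : nm (x ** y) <= nm x * nm y.
Proof. by rewrite -lecR rmorphM /= -!nmE bnormM. Qed.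

Lemma left_right_inv x a y : x ** a = one -> a ** y = one -> x = y.
Proof. by move=> xa ay; rewrite -[x](bmul1r m) -ay bmulA xa bmul1l. Qed.

Lemma binvP a : binvertible m a -> a ** binv m a = one /\ binv m a ** a = one.
Proof. by move=> h; exact: (xgetPex 0 h). Qed.

Lemma binvE a c : a ** c = one -> c ** a = one -> binv m a = c.
Proof.
move=> ac ca; have [|h _] := binvP (a := a); first by exists c.
by apply/esym/(left_right_inv ca).
Qed.

Lemma bmulVr a : binvertible m a -> a ** binv m a = one.
Proof. by case/binvP. Qed.

Lemma bmulVl a : binvertible m a -> binv m a ** a = one.
Proof. by case/binvP. Qed.

Lemma binvertibleM a b : binvertible m a -> binvertible m b -> binvertible m (a ** b).
Proof.
move=> [a' [aa' a'a]] [b' [bb' b'b]]; exists (b' ** a'); split.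
  by rewrite bmulA -(bmulA m a) bb' bmul1r.
by rewrite bmulA -(bmulA m b') a'a bmul1r.
Qed.

Lemma binvertible1 : binvertible m one.
Proof. by exists one; rewrite bmul1l. Qed.

Fixpoint bexp w n := if n is k.+1 then w ** bexp w k else one.

Lemma bexpSr w n : bexp w n.+1 = bexp w n ** w.
Proof.
by elim: n => [|n IH]; rewrite /= ?bmul1l ?bmul1r // -bmulA -IH.
Qed.

Lemma nm_bexp w n : nm (bexp w n) <= nm one * nm w ^+ n.
Proof.
elim: n => [|n IH] /=; first by rewrite expr0 mulr1.
apply: le_trans (nm_bmul _ _) _; rewrite exprS mulrCA.
by apply: ler_wpM2l => //; exact: nm_ge0.
Qed.

Fixpoint geom w n := if n is k.+1 then geom w k + bexp w k else 0.

Lemma geomS w n : geom w n.+1 = one + w ** geom w n.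
Proof.
elim: n => [|n IH]; first by rewrite /= add0r bmul0r addr0.
have E k : geom w k.+1 = geom w k + bexp w k by [].
by rewrite (E n.+1) [in LHS]IH -[bexp w n.+1]/(w ** bexp w n) -addrA -bmulDr -E.
Qed.

Lemma geomSr w n : geom w n.+1 = one + geom w n ** w.
Proof.
elim: n => [|n IH]; first by rewrite /= add0r bmul0l addr0.
have E k : geom w k.+1 = geom w k + bexp w k by [].
by rewrite (E n.+1) [in LHS]IH bexpSr -addrA -bmulDl -E.
Qed.

Lemma neumann w : nm w < 1 -> binvertible m (one - w).
Proof.
move=> w1; have w01 : 0 <= nm w < 1 by rewrite nm_ge0.
have [|l hl] := @geometric_cvg _ _ (geom w) (nm one) _ w01.
  by move=> n; rewrite /= addrAC subrr add0r nm_bexp.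
have zero x : (exists c : R, forall n, nm x <= c * nm w ^+ n) -> x = 0.
  move=> [c hc]; apply: nm_eq0; apply/eqP; rewrite eq_le nm_ge0 andbT.
  apply/ler_addgt0Pr => e e0; rewrite add0r; have [n hn] := geometric_small c w01 e0.
  exact: ltW (le_lt_trans (hc n) hn).
set D := _ / _ in hl.
have D0 : 0 <= D.
  by have := hl 0%N; rewrite expr0 mulr1; apply: le_trans; exact: nm_ge0.
(* The partial sums satisfy the fixed-point equation of [l] up to a shift of the index, so the
   defect of [l] is controlled by two distances, each at most D |w|^n. *)
have bound x n : nm x <= nm (l - geom w n.+1) + nm w * nm (l - geom w n) ->
    nm x <= (2 * D) * nm w ^+ n.
  have := hl n; have := hl n.+1; rewrite exprS => h1 h2 /le_trans; apply.
  have : 0 <= nm w ^+ n by rewrite exprn_ge0 // nm_ge0.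
  have := nm_ge0 w; move: h1 h2; set e := _ ^+ n; set N := nm w.
  move=> h1 h2 N0 e0.
  have h3 : N * nm (l - geom w n) <= N * (D * e) by apply: ler_wpM2l.
  have h4 : N * (D * e) <= D * e by apply: ler_piMl; [exact: mulr_ge0 | exact: ltW].
  by move: h1; rewrite mulrCA; lra.
have e1 : l - (one + w ** l) = 0.
  apply: zero; exists (2 * D) => n; apply: bound.
  have -> : l - (one + w ** l) = (l - geom w n.+1) - w ** (l - geom w n).
    by rewrite geomS bmulBr !opprD !opprK !addrA [RHS](ACl (1 * 2 * 4 * (5 * 3))) /= subrr addr0.
  apply: le_trans (nmD _ _) _; rewrite nmN; apply: lerD => //; exact: nm_bmul.
have e2 : l - (one + l ** w) = 0.
  apply: zero; exists (2 * D) => n; apply: bound.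
  have -> : l - (one + l ** w) = (l - geom w n.+1) - (l - geom w n) ** w.
    by rewrite geomSr bmulBl !opprD !opprK !addrA [RHS](ACl (1 * 2 * 4 * (5 * 3))) /= subrr addr0.
  apply: le_trans (nmD _ _) _; rewrite nmN; apply: lerD => //.
  by rewrite mulrC; exact: nm_bmul.
exists l; rewrite bmulBl bmulBr bmul1l bmul1r; split; apply/eqP; rewrite subr_eq -subr_eq0.
  by rewrite e1.
by rewrite e2.
Qed.

(** An exact remainder instead of an infinite series. It serves both to approximate resolvents by
    polynomials in [w] and to apply [E] term by term. *)
Lemma geom_remainder w z n : (one - w) ** z = one ->
  z = geom w n + bexp w n ** z.
Proof.
move=> h; have zE : z = one + w ** z.
  by apply/eqP; rewrite -subr_eq -[X in X - _](bmul1l m) -bmulBl h.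
elim: n => [|n IH]; first by rewrite /= add0r bmul1l.
by rewrite /= -addrA {1}IH; congr (_ + _); rewrite {1}zE bmulDr bmul1r bmulA -bexpSr.
Qed.

(** From c^-1 - a^-1 = c^-1 (a - c) a^-1; the threshold 1/2 lets |c^-1| be absorbed, giving |c^-1|
    <= 2 |a^-1|. *)
Lemma binv_perturb a c : binvertible m a -> nm (c - a) * nm (binv m a) <= 2^-1 ->
  binvertible m c /\ nm (binv m c - binv m a) <= 2 * nm (binv m a) ^+ 2 * nm (c - a).
Proof.
move=> ai; have [aV Va] := binvP ai; set a' := binv m a in aV Va *; move=> ca.
have ci : binvertible m c.
  have -> : c = a ** (one - a' ** (a - c)).
    by rewrite bmulBr bmul1r bmulA aV bmul1l opprB addrC subrK.
  apply: binvertibleM ai _; apply: neumann.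
  apply: le_lt_trans (nm_bmul _ _) _; rewrite nmB mulrC; apply: le_lt_trans ca _; lra.
have [cV Vc] := binvP ci; split=> //; set c' := binv m c in cV Vc *.
have E : c' - a' = c' ** (a - c) ** a'.
  by rewrite bmulBr bmulBl Vc bmul1l -bmulA aV bmul1r.
have h1 : nm (c' - a') <= nm c' * nm (c - a) * nm a'.
  rewrite E; apply: le_trans (nm_bmul _ _) _; apply: ler_wpM2r; first exact: nm_ge0.
  by apply: le_trans (nm_bmul _ _) _; rewrite [nm (c - a)]nmB.
have h2 : nm c' <= nm a' + nm (c' - a').
  by rewrite -{1}(subrK a' c') addrC; exact: nmD.
have h3 := nm_ge0 c'; have h4 := nm_ge0 a'; have h5 := nm_ge0 (c - a).
have h6 : nm c' <= 2 * nm a' by nra.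
apply: le_trans h1 _; rewrite expr2.
have : nm c' * (nm (c - a) * nm a') <= 2 * nm a' * (nm (c - a) * nm a').
  by apply: ler_wpM2r => //; exact: mulr_ge0.
lra.
Qed.

Lemma bmul_continuous a b (e : R) : 0 < e -> exists2 d : R, 0 < d &
  forall a' b', nm (a' - a) < d -> nm (b' - b) < d -> nm (a' ** b' - a ** b) < e.
Proof.
move=> e0; pose M := nm a + nm b + 1 + 1.
have M0 : 0 < M by rewrite ltr_wpDl // addr_ge0 // addr_ge0 // nm_ge0.
exists (Num.min (e / (2 * M)) 1); first by rewrite lt_min ltr01 divr_gt0 // mulr_gt0.
move=> a' b'; rewrite !lt_min => /andP[f1 f2] /andP[g1 g2].
have -> : a' ** b' - a ** b = (a' - a) ** b' + a ** (b' - b).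
  by rewrite bmulBl bmulBr addrA subrK.
apply: le_lt_trans (nmD _ _) _.
have n1 := nm_bmul (a' - a) b'; have n2 := nm_bmul a (b' - b).
have n3 : nm b' <= nm b + 1.
  by rewrite -(subrK b b') addrC; apply: le_trans (nmD _ _) _; rewrite lerD2l ltW.
have n4 := nm_ge0 (a' - a); have n5 := nm_ge0 (b' - b); have n6 := nm_ge0 a.
have n7 := nm_ge0 b'; have n8 := nm_ge0 b.
have p1 : nm (a' - a) * nm b' <= e / (2 * M) * (nm b + 1).
  by apply: ler_pM => //; exact: ltW.
have p2 : nm a * nm (b' - b) <= nm a * (e / (2 * M)).
  by apply: ler_wpM2l => //; exact: ltW.
have p3 : e / (2 * M) * M = e / 2 by field; exact: lt0r_neq0.
have p4 : 0 < e / (2 * M) by rewrite divr_gt0 // mulr_gt0.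
move: p1 p2 p3 p4; rewrite /M; set q := e / _; nra.
Qed.

Section Limits.
Variable U : normedModType R[i].
Implicit Types f g : U -> A.

Lemma cvg0_bmul f g a b : f @ (0 : U) --> a -> g @ (0 : U) --> b ->
  (fun h => f h ** g h) @ (0 : U) --> a ** b.
Proof.
move=> /cvg0P fa /cvg0P gb; apply/cvg0P => e /(bmul_continuous a b)[d d0 hd].
have [d1 d10 h1] := fa _ d0; have [d2 d20 h2] := gb _ d0.
exists (Num.min d1 d2); first by rewrite lt_min d10.
by move=> h; rewrite lt_min => /andP[/h1 fh /h2 gh]; exact: hd.
Qed.

Lemma cvg0_binv f a : binvertible m a -> f @ (0 : U) --> a ->
  (\forall h \near (0 : U), binvertible m (f h)) /\
  (fun h => binv m (f h)) @ (0 : U) --> binv m a.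
Proof.
move=> ai fa; set N := nm (binv m a).
have N0 : 0 <= N by exact: nm_ge0.
have N1 : 0 < 2 * (N + 1) by rewrite mulr_gt0 // ltr_wpDl.
split.
  have e0 : 0 < (2 * (N + 1))^-1 by rewrite invr_gt0.
  have /cvg0P/(_ _ e0)[d d0 hd] := fa; apply/nearP; exists d => // h /hd fh.
  have [] // := @binv_perturb a (f h) ai; rewrite -/N.
  move: (ltW fh); rewrite -[_^-1]mul1r ler_pdivlMr // => ?.
  by have := nm_ge0 (f h - a); lra.
apply/cvg0P => e e0.
pose dl := Num.min (2 * (N + 1))^-1 (e / (2 * N ^+ 2 + 1)).
have N2 : 0 < 2 * N ^+ 2 + 1 by rewrite ltr_wpDl // mulr_ge0 // sqr_ge0.
have dl0 : 0 < dl by rewrite lt_min invr_gt0 N1 divr_gt0.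
have /cvg0P/(_ _ dl0)[d d0 hd] := fa; exists d => // h /hd.
rewrite lt_min => /andP[f1 f2].
have [|_ b] := @binv_perturb a (f h) ai; rewrite -/N.
  move: (ltW f1); rewrite -[_^-1]mul1r ler_pdivlMr // => ?.
  by have := nm_ge0 (f h - a); lra.
apply: le_lt_trans b _; move: f2; rewrite ltr_pdivlMr // -/N; have := nm_ge0 (f h - a).
by have := sqr_ge0 N; nra.
Qed.
End Limits.
End BanachAlg.

(** * Holomorphic curves *)

Section Cdiff.
Variables (R : realType).
Local Notation C := (R[i]^o).
Implicit Types (z : C) (V W : normedModType R[i]).

Lemma nmVl (z : C) : z != 0 -> nm (z^-1 : C) * nm z = 1.
Proof. by move=> z0; rewrite -nmM mulVf // -(rmorph1 (real_complex R)) nmC normr1. Qed.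

Lemma cvg0_near (U V : normedModType R[i]) (f g : U -> V) (a : V) :
  (\forall h \near (0 : U), f h = g h) -> g @ (0 : U) --> a -> f @ (0 : U) --> a.
Proof.
move=> /nearP[d d0 fg] /cvg0P ga; apply/cvg0P => e /ga[d' d'0 h].
exists (Num.min d d'); first by rewrite lt_min d0.
by move=> x; rewrite lt_min => /andP[/fg -> /h].
Qed.

Lemma cvg0_linear (U V W : normedModType R[i]) (T : V -> W) (M : R) (f : U -> V) (a : V) :
  (forall v w, T (v + w) = T v + T w) -> (forall (k : R[i]) v, T (k *: v) = k *: T v) ->
  (forall v, nm (T v) <= M * nm v) -> f @ (0 : U) --> a ->
  (fun h => T (f h)) @ (0 : U) --> T a.
Proof.
move=> TD TZ TM /cvg0P fa; apply/cvg0P => e e0.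
have M0 : 0 < `|M| + 1 by rewrite ltr_wpDl.
have [|d d0 hd] := fa (e / (`|M| + 1)); first by rewrite divr_gt0.
exists d => // h /hd; rewrite ltr_pdivlMr // => hh.
rewrite -scaleN1r -TZ scaleN1r -TD; apply: le_lt_trans (TM _) _.
have := nm_ge0 (f h - a); have := ler_norm M; nra.
Qed.

Lemma cdiff_near V (f g : C -> V) z :
  (\forall h \near (0 : C), f (z + h) = g (z + h)) -> cdiff g z -> cdiff f z.
Proof.
move=> fg [phi [phi0 hphi]]; exists phi; split=> //.
have fz : f z = g z by have := nbhs_singleton fg; rewrite addr0.
by rewrite fz; apply: filterS2 fg hphi => h -> ->.
Qed.

Lemma cdiff_shift V (f : C -> V) z : cdiff (fun t => f (z + t)) 0 -> cdiff f z.
Proof.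
move=> [phi [phi0 hphi]]; exists phi; split=> //.
by apply: filterS hphi => h; rewrite add0r addr0.
Qed.

Lemma cdiff_cst V (a : V) z : cdiff (fun _ => a) z.
Proof.
exists (fun _ => 0); split; first exact: cvg0_cst.
by apply/nearP; exists 1 => // h _; rewrite scaler0 addr0.
Qed.

Lemma cdiff_line V (a e : V) z : cdiff (fun t => a + (t : R[i]) *: e) z.
Proof.
exists (fun _ => e); split; first exact: cvg0_cst.
by apply/nearP; exists 1 => // h _; rewrite scalerDl addrA.
Qed.

Lemma cdiff_cvg V (f : C -> V) z : cdiff f z -> (fun h => f (z + h)) @ (0 : C) --> f z.
Proof.
move=> [phi [phi0 hphi]]; apply: cvg0_near hphi _.
rewrite -[X in _ --> X]addr0 -[X in _ + X](scale0r (phi 0)).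
apply: cvg0D; first exact: cvg0_cst.
by apply: cvg0Z phi0; apply/cvg0P => e e0; exists e => // h; rewrite subr0.
Qed.

Lemma cdiffD V (f g : C -> V) z : cdiff f z -> cdiff g z -> cdiff (fun t => f t + g t) z.
Proof.
move=> [phi [phi0 hphi]] [psi [psi0 hpsi]]; exists (fun h => phi h + psi h); split.
  exact: cvg0D.
by apply: filterS2 hphi hpsi => h -> ->; rewrite scalerDr addrACA.
Qed.

Lemma cdiff_linear V W (T : V -> W) (M : R) (f : C -> V) z :
  (forall v w, T (v + w) = T v + T w) -> (forall (k : R[i]) v, T (k *: v) = k *: T v) ->
  (forall v, nm (T v) <= M * nm v) -> cdiff f z -> cdiff (fun t => T (f t)) z.
Proof.
move=> TD TZ TM [phi [phi0 hphi]]; exists (fun h => T (phi h)); split.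
  exact: cvg0_linear TM phi0.
by apply: filterS hphi => h ->; rewrite TD TZ.
Qed.

Lemma cdiffB V (f g : C -> V) z : cdiff f z -> cdiff g z -> cdiff (fun t => f t - g t) z.
Proof.
move=> fd gd; apply: cdiffD fd _.
apply: (@cdiff_linear _ _ (fun v => - v) 1) gd => [v w|k v|v].
- by rewrite opprD.
- by rewrite scalerN.
- by rewrite nmN mul1r.
Qed.

(** The bridge from Frechet differentiability on B, as in [holo_near0], to curves. The slope is the
    difference quotient, completed at h = 0 by the chain rule value. *)
Lemma cdiff_comp V W (F : V -> W) (f : C -> V) z :
  differentiable F (f z) -> cdiff f z -> cdiff (fun t => F (f t)) z.
Proof.
move=> dF [phi [phi0 hphi]]; set L := 'd F (f z).
pose psi (h : C) := if h == 0 then L (phi 0) else h^-1 *: (F (f (z + h)) - F (f z)).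
exists psi; split; last first.
  apply/nearP; exists 1 => // h _; rewrite /psi; case: eqVneq => [->|h0].
    by rewrite addr0 scale0r addr0.
  by rewrite scalerA mulfV // scale1r [RHS]addrC subrK.
have -> : psi 0 = L (phi 0) by rewrite /psi eqxx.
have Lc : continuous L by exact: diff_continuous.
have Lphi : (fun h => L (phi h)) @ (0 : C) --> L (phi 0).
  exact: (cvg_comp _ _ phi0 (Lc (phi 0))).
have Fo (e : R) : 0 < e -> exists2 d : R, 0 < d &
    forall v, nm v < d -> nm (F (v + f z) - F (f z) - L v) <= e * nm v.
  move=> e0; have /eqaddoP := diff_locally dF.
  move=> /(_ e%:C); rewrite ltcR => /(_ e0)/nearP[d d0 hd]; exists d => // v /hd.
  rewrite !nmE -rmorphM lecR /= => h; apply: le_trans h.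
  by rewrite /= opprD addrA.
apply/cvg0P => e e0.
(* Bounds |phi h| near 0, so that a remainder of e / (2 M) times |h phi h| is at most (e / 2)
   |h|. *)
pose M := nm (phi 0) + 1; have M0 : 0 < M by rewrite ltr_wpDl // nm_ge0.
have [|d1 d10 h1] := Fo (e / (2 * M)); first by rewrite divr_gt0 // mulr_gt0.
have /cvg0P/(_ _ ltr01)[d2 d20 h2] := phi0.
have [|d3 d30 h3] := (cvg0P _ _).1 Lphi (e / 2); first by rewrite divr_gt0.
have /nearP[d4 d40 h4] := hphi.
exists (Num.min (Num.min d2 d3) (Num.min d4 (d1 / M))).
  by rewrite !lt_min d20 d30 d40 divr_gt0.
move=> h; rewrite !lt_min => /andP[/andP[/h2 k2 /h3 k3] /andP[/h4 k4]].
rewrite ltr_pdivlMr // => k1; rewrite /psi; case: eqVneq => [_|h0].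
  by rewrite subrr nm0.
have hp : nm (phi h) <= M.
  by rewrite -(subrK (phi 0) (phi h)) addrC; apply: le_trans (nmD _ _) _; rewrite lerD2l ltW.
have hh : 0 < nm h.
  by rewrite lt_neqAle nm_ge0 andbT; apply/eqP => /esym/nm_eq0/eqP; apply/negP.
have := h1 (h *: phi h); rewrite [h *: _ + _]addrC -k4 !nmZ => k5.
have LZ : L (h *: phi h) = h *: L (phi h) by exact: linearZ.
rewrite {}LZ in k5.
have {}k5 := k5 (le_lt_trans (ler_wpM2l (nm_ge0 h) hp) k1).
have hV : nm (h^-1 : C) * nm h = 1.
  exact: nmVl.
have -> : h^-1 *: (F (f (z + h)) - F (f z)) - L (phi 0) =
   h^-1 *: (F (f (z + h)) - F (f z) - h *: L (phi h)) + (L (phi h) - L (phi 0)).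
  by rewrite [h^-1 *: (_ - h *: _)]scalerBr scalerA mulVf // scale1r addrA subrK.
apply: le_lt_trans (nmD _ _) _; rewrite nmZ.
have k6 : nm (h^-1 : C) * nm (F (f (z + h)) - F (f z) - h *: L (phi h)) <= e / (2 * M) * M.
  apply: le_trans (ler_wpM2l (nm_ge0 (h^-1 : C)) k5) _.
  have -> : nm (h^-1 : C) * (e / (2 * M) * (nm h * nm (phi h))) =
    (nm (h^-1 : C) * nm h) * (e / (2 * M) * nm (phi h)) by ring.
  rewrite hV mul1r; apply: ler_wpM2l => //; rewrite divr_ge0 ?mulr_ge0 // ltW //.
have : e / (2 * M) * M = e / 2 by field; exact: lt0r_neq0.
lra.
Qed.

Section Algebra.
Variables (A : completeNormedModType R[i]) (m : banach_alg A).

Lemma cdiff_bmul (f g : C -> A) z :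
  cdiff f z -> cdiff g z -> cdiff (fun t => bmul m (f t) (g t)) z.
Proof.
move=> [phi [phi0 hphi]] gd; have gc := cdiff_cvg gd; case: gd => psi [psi0 hpsi].
exists (fun h => bmul m (phi h) (g (z + h)) + bmul m (f z) (psi h)); split.
  rewrite addr0; apply: cvg0D; apply: cvg0_bmul => //; exact: cvg0_cst.
apply: filterS2 hphi hpsi => h fh gh.
rewrite fh bmulDl {1}gh bmulDr bmulZr bmulZl scalerDr -!addrA; congr (_ + _).
by rewrite addrC.
Qed.

(** The slope is read off from the resolvent identity for f (z + h) and f z. *)
Lemma cdiff_binv (f : C -> A) z :
  binvertible m (f z) -> cdiff f z -> cdiff (fun t => binv m (f t)) z.
Proof.
move=> fi fd; have [fn fV] := cvg0_binv fi (cdiff_cvg fd).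
case: fd => phi [phi0 hphi].
exists (fun h => - bmul m (bmul m (binv m (f (z + h))) (phi h)) (binv m (f z))); split.
  rewrite addr0 -!(bmulNr m); apply: cvg0_near; last first.
    apply: cvg0_bmul (cvg0_bmul fV phi0) _; exact: cvg0_cst.
  by apply/nearP; exists 1 => // h _; rewrite bmulNr.
apply: filterS2 fn hphi => h hi fh.
apply/eqP; rewrite [eqbRHS]addrC -subr_eq; apply/eqP.
have {}fh : h *: phi h = f (z + h) - f z by rewrite fh addrC addKr.
rewrite scalerN -bmulZl -bmulZr fh bmulBr bmulBl bmulVl // bmul1l -bmulA bmulVr //.
by rewrite bmul1r opprB.
Qed.

Lemma left_division_unique (D : A -> A) :
  (\forall b \near (0 : A), cdiff (fun t : C => D (b + (t : R[i]) *: bone m)) 0) ->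
  (\forall b \near (0 : A), bmul m b (D b) = 0) -> \forall b \near (0 : A), D b = 0.
Proof.
move=> Dd /(filterI Dd)/nearP[r r0 hr].
set N := nm (bone m); have N0 : 0 <= N by exact: nm_ge0.
have N1 : 0 < 4 * (N + 1) by rewrite mulr_gt0 // ltr_wpDl.
(* Chosen so that |b| + 2 c N < r for |b| < c: the whole disc of radius 2 c about b, in the
   direction of the unit, stays where both hypotheses hold. *)
pose c := r / (4 * (N + 1)); have c0 : 0 < c by rewrite divr_gt0.
have rc : r = c * (4 * (N + 1)) by rewrite /c divfK // lt0r_neq0.
apply/nearP; exists c => // b bc.
have small (z : C) : nm z <= 2 * c -> nm (b + (z : R[i]) *: bone m) < r.
  move=> zc; apply: le_lt_trans (nmD _ _) _; rewrite nmZ -/N rc.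
  by have := ler_wpM2r N0 zc; nra.
have -> : D b = D (b + (0 : R[i]) *: bone m) by rewrite scale0r addr0.
apply: (@cdiff_eq0 _ _ (fun t : C => D (b + (t : R[i]) *: bone m)) c c0) => z.
  move=> /small/hr[/= h _]; apply: cdiff_shift.
  by apply: cdiff_near h; apply/nearP; exists 1 => // t _; rewrite add0r scalerDl addrA.
move=> /andP[cz zc]; have [_ /= h] := hr _ (small z zc).
have z0 : z != 0 by apply: contraTneq cz => ->; rewrite nm0 -ltNge.
have [a' [_ a'a]] : binvertible m (b + (z : R[i]) *: bone m).
  have -> : b + (z : R[i]) *: bone m =
      bmul m (z *: bone m) (bone m - (- (z^-1 : R[i]) *: b)).
    by rewrite bmulZ1l scalerBr scalerA mulrN mulfV // scaleN1r opprK addrC.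
  apply: binvertibleM.
    by exists (z^-1 *: bone m); rewrite !bmulZ1l !scalerA mulfV // mulVf // scale1r.
  apply: neumann; rewrite nmZ.
  have := nmN (z^-1 : C) => ->.
  have zV : nm (z^-1 : C) * nm z = 1.
    exact: nmVl.
  rewrite -zV ltr_pM2l ?(lt_le_trans bc) //.
  rewrite lt_neqAle nm_ge0 andbT; apply/eqP => e; move: zV; rewrite -e mul0r.
  by move/esym/eqP; rewrite oner_eq0.
have : bmul m a' 0 = 0 by exact: bmul0r.
by rewrite -{1}h bmulA a'a bmul1l.
Qed.
End Algebra.
End Cdiff.

(** * Closed subalgebras and freeness *)

Section Ncps.
Variables (R : realType) (B A : completeNormedModType R[i]).
Variables (mB : banach_alg B) (mA : banach_alg A) (iota : B -> A) (E : A -> B).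
Hypothesis ncps : banach_ncps mB mA iota E.
Local Notation C := (R[i]^o).
Local Notation "x ** y" := (bmul mA x y) (at level 40, left associativity).
Local Notation "x *b y" := (bmul mB x y) (at level 40, left associativity).
Local Notation oneA := (bone mA).
Local Notation oneB := (bone mB).
Implicit Types (a c x y z w : A) (b : B).

Lemma embD b1 b2 : iota (b1 + b2) = iota b1 + iota b2.
Proof. by case: ncps => -[]. Qed.

Lemma embZ (k : R[i]) b : iota (k *: b) = k *: iota b.
Proof. by case: ncps => -[]. Qed.

Lemma embM b1 b2 : iota (b1 *b b2) = iota b1 ** iota b2.
Proof. by case: ncps => -[]. Qed.

Lemma emb1 : iota oneB = oneA.
Proof. by case: ncps => -[]. Qed.

Lemma nm_iota b : nm (iota b) = nm b.
Proof. by case: ncps => -[_ _ _ _ h] _; rewrite /nm h. Qed.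

Lemma emb0 : iota 0 = 0.
Proof. by rewrite -(scale0r (0 : B)) embZ scale0r. Qed.

Lemma ED a1 a2 : E (a1 + a2) = E a1 + E a2.
Proof. by case: ncps => _ []. Qed.

Lemma EZ (k : R[i]) a : E (k *: a) = k *: E a.
Proof. by case: ncps => _ []. Qed.

Lemma EB a1 a2 : E (a1 - a2) = E a1 - E a2.
Proof. by rewrite ED -scaleN1r EZ scaleN1r. Qed.

Lemma E_iota b : E (iota b) = b.
Proof. by case: ncps => _ []. Qed.

Lemma E1 : E oneA = oneB.
Proof. by rewrite -emb1 E_iota. Qed.

Lemma E_mull b a : E (iota b ** a) = b *b E a.
Proof.
case: ncps => _ [_ _ _ _ /(_ b oneB a)].
by rewrite emb1 !bmul1r.
Qed.

Lemma E_mulr b a : E (a ** iota b) = E a *b b.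
Proof.
case: ncps => _ [_ _ _ _ /(_ oneB b a)].
by rewrite emb1 !bmul1l.
Qed.

Lemma E_bounded : exists2 M : R, 0 <= M & forall a, nm (E a) <= M * nm a.
Proof.
have [_ [_ _ [M hM] _ _]] := ncps; exists `|complex.Re M| => // a.
have := hM a; rewrite !nmE lecE => /andP[_ h].
apply: le_trans h _.
have -> : complex.Re (M * (nm a)%:C) = complex.Re M * nm a.
  by case: (M) => p q /=; rewrite mulr0 subr0.
by apply: ler_wpM2r; [exact: nm_ge0 | exact: ler_norm].
Qed.

(** The norm closure of the generated subalgebra: the resolvents of elements such as b x belong to
    it, but in general not to the subalgebra. *)
Definition alg_closure x a := forall e : R, 0 < e ->
  exists2 a', gen_subalg mA iota x a' & nm (a - a') < e.

Lemma gen_subalgB x a1 a2 : gen_subalg mA iota x a1 -> gen_subalg mA iota x a2 ->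
  gen_subalg mA iota x (a1 - a2).
Proof. by move=> h1 h2; rewrite -scaleN1r; apply: gen_add => //; exact: gen_scale. Qed.

Lemma alg_closure_gen x a : gen_subalg mA iota x a -> alg_closure x a.
Proof. by move=> xa e e0; exists a => //; rewrite subrr nm0. Qed.

Lemma alg_closureD x a1 a2 : alg_closure x a1 -> alg_closure x a2 -> alg_closure x (a1 + a2).
Proof.
move=> h1 h2 e e0; have e20 : 0 < e / 2 by rewrite divr_gt0.
have [a1' g1 d1] := h1 _ e20; have [a2' g2 d2] := h2 _ e20.
exists (a1' + a2'); first exact: gen_add.
rewrite opprD addrACA; apply: le_lt_trans (nmD _ _) _; lra.
Qed.

Lemma alg_closureM x a1 a2 : alg_closure x a1 -> alg_closure x a2 -> alg_closure x (a1 ** a2).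
Proof.
move=> h1 h2 e /(bmul_continuous mA a1 a2)[d d0 hd].
have [a1' g1 d1] := h1 _ d0; have [a2' g2 d2] := h2 _ d0.
exists (a1' ** a2'); first exact: gen_mul.
by rewrite nmB; apply: hd; rewrite nmB.
Qed.

Lemma alg_closure_iota x b : alg_closure x (iota b).
Proof. by apply: alg_closure_gen; exact: gen_B. Qed.

Lemma alg_closureB x a1 a2 : alg_closure x a1 -> alg_closure x a2 -> alg_closure x (a1 - a2).
Proof.
move=> h1 h2; have <- : iota (- oneB) ** a2 = - a2.
  by rewrite -(scaleN1r oneB) embZ emb1 bmulZ1l scaleN1r.
by apply: alg_closureD => //; apply: alg_closureM => //; exact: alg_closure_iota.
Qed.

Lemma alg_closure_binv x w : nm w < 1 -> alg_closure x w ->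
  alg_closure x (binv mA (oneA - w)).
Proof.
move=> w1 xw e e0; set z := binv mA _.
have w01 : 0 <= nm w < 1 by rewrite nm_ge0.
have zP : (oneA - w) ** z = oneA by apply: bmulVr; exact: neumann.
have e20 : 0 < e / 2 by rewrite divr_gt0.
have [n hn] := geometric_small (nm oneA * nm z) w01 e20.
have xe k : alg_closure x (bexp mA w k).
  elim: k => [|k IH] /=; last exact: alg_closureM.
  by rewrite -emb1; exact: alg_closure_iota.
have xg k : alg_closure x (geom mA w k).
  elim: k => [|k IH] /=; last exact: alg_closureD.
  by rewrite -emb0; exact: alg_closure_iota.
have [a' ga da] := xg n _ e20; exists a' => //.
rewrite (geom_remainder n zP) addrAC; apply: le_lt_trans (nmD _ _) _.
have : nm (bexp mA w n ** z) <= nm oneA * nm z * nm w ^+ n.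
  apply: le_trans (nm_bmul _ _ _) _; rewrite mulrAC; apply: ler_wpM2r.
    exact: nm_ge0.
  exact: nm_bexp.
lra.
Qed.

(** The flag [i] selects the first letter, so that one family contains (a c)^n, (a c)^n a, c (a c)^n
    and c (a c)^n a, the words met when a Neumann series is multiplied by a or c. *)
Fixpoint alt_prod a c (i : bool) k :=
  if k is k'.+1 then (if i then a else c) ** alt_prod a c (~~ i) k' else oneA.

Lemma alt_prod_continuous a c i k (e : R) : 0 < e -> exists2 d : R, 0 < d &
  forall a' c', nm (a' - a) < d -> nm (c' - c) < d ->
    nm (alt_prod a' c' i k - alt_prod a c i k) < e.
Proof.
elim: k i e => [|k IH] i e e0 /=.
  by exists 1 => // a' c' _ _; rewrite subrr nm0.
have [d1 d10 h1] :=
  bmul_continuous mA (if i then a else c) (alt_prod a c (~~ i) k) e0.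
have [d2 d20 h2] := IH (~~ i) _ d10.
exists (Num.min d1 d2); first by rewrite lt_min d10.
move=> a' c'; rewrite !lt_min => /andP[p1 p2] /andP[q1 q2].
apply: h1; last exact: h2.
by case: ifP.
Qed.

(** * Freeness on the closed subalgebras *)

Section Free.
Variables x y : A.
Hypothesis xy_free : free_in mA iota E x y.

Lemma free_alt_prod_gen a c i k :
  gen_subalg mA iota x a -> E a = 0 -> gen_subalg mA iota y c -> E c = 0 ->
  E (alt_prod a c i k.+1) = 0.
Proof.
move=> xa Ea yc Ec; pose t (i : bool) := (i, if i then a else c).
pose word := fix word i k := if k is k'.+1 then t i :: word (~~ i) k' else [::].
have sz k' : forall i, size (word i k') = k' by elim: k' => //= k' IH i'; rewrite IH.
have prodE k' : forall i, bprod mA (map snd (word i k')) = alt_prod a c i k'.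
  by elim: k' => //= k' IH i'; rewrite -IH.
(* The tag of the j-th letter is the first tag flipped j times; alternation of tags follows by
   parity. *)
have nthE k' : forall i j, (j < k')%N -> nth (true, 0) (word i k') j = t (i (+) odd j).
  elim: k' => //= k' IH i' [_|j jk] /=; first by rewrite addbF.
  by rewrite IH // addNb addbN.
rewrite -prodE; apply: xy_free => // j; rewrite sz => jk.
  by rewrite !nthE //; [rewrite /= addbN; case: (_ (+) _) | exact: ltnW].
by rewrite nthE //=; case: (_ (+) _).
Qed.

(** Freeness applies to approximants only if they are centred too. Subtracting E a' achieves this,
    and since E a = 0 it multiplies the distance by at most 1 + M. *)
Lemma centered_approx z a (e : R) : 0 < e -> alg_closure z a -> E a = 0 ->
  exists a', [/\ gen_subalg mA iota z a', E a' = 0 & nm (a' - a) < e].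
Proof.
move=> e0 za Ea; have [M M0 EM] := E_bounded.
have [|a' ga da] := za (e / (1 + M)); first by rewrite divr_gt0 // ltr_wpDr.
exists (a' - iota (E a')); split.
- by apply: gen_subalgB => //; exact: gen_B.
- by rewrite EB E_iota subrr.
have -> : a' - iota (E a') - a = (a' - a) - iota (E (a' - a)).
  by rewrite EB Ea subr0 addrAC.
apply: le_lt_trans (nmD _ _) _; rewrite nmN nm_iota.
have := EM (a' - a); move: da; rewrite nmB ltr_pdivlMr ?ltr_wpDr //.
by have := nm_ge0 (a' - a); lra.
Qed.

Lemma free_alt_prod a c i k :
  alg_closure x a -> E a = 0 -> alg_closure y c -> E c = 0 -> (0 < k)%N ->
  E (alt_prod a c i k) = 0.
Proof.
case: k => // k xa Ea yc Ec _; have [M M0 EM] := E_bounded.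
apply: nm_eq0; apply/eqP; rewrite eq_le nm_ge0 andbT.
apply/ler_addgt0Pr => e e0; rewrite add0r.
have [|d d0 hd] := @alt_prod_continuous a c i k.+1 (e / (M + 1)).
  by rewrite divr_gt0 // ltr_wpDl.
have [a' [ga Ea' da]] := centered_approx d0 xa Ea.
have [c' [gc Ec' dc]] := centered_approx d0 yc Ec.
have := hd a' c' da dc; set u := alt_prod a' c' i k.+1; set v := alt_prod a c i k.+1.
rewrite ltr_pdivlMr ?ltr_wpDl // => huv.
have -> : E v = E (v - u) by rewrite EB (free_alt_prod_gen _ _ ga) // subr0.
apply: le_trans (EM _) _; rewrite nmB; have := nm_ge0 (u - v); lra.
Qed.

Lemma bexp_alt_prod a c n : bexp mA (a ** c) n = alt_prod a c true n.*2.
Proof. by elim: n => [//|n IH]; rewrite doubleS /= IH bmulA. Qed.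

Lemma bexp_alt_prodS a c n : bexp mA (a ** c) n ** a = alt_prod a c true n.*2.+1.
Proof.
elim: n => [|n IH]; first by rewrite /= bmul1l bmul1r.
by rewrite doubleS /= -bmulA IH /= !bmulA.
Qed.

(* Only the term of degree zero survives in the Neumann expansion: every other
   term is, up to a left factor from B, an alternating product of a and c. *)
Lemma E_free_resolvent a c b :
  alg_closure x a -> E a = 0 -> alg_closure y c -> E c = 0 -> nm (a ** c) < 1 ->
  E ((oneA + iota b + iota b ** c) ** binv mA (oneA - a ** c) ** (oneA + a)) = oneB + b.
Proof.
move=> xa Ea yc Ec ac1; set al := _ + _ ** c; set be := oneA + a; set z := binv mA _.
set w := a ** c in ac1 z *.
have zP : (oneA - w) ** z = oneA by apply: bmulVr; exact: neumann.
have ac_free i k : (0 < k)%N -> E (alt_prod a c i k) = 0 by move=> ?; exact: free_alt_prod.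
have term n : E (al ** bexp mA w n ** be) = if n == 0%N then oneB + b else 0.
  rewrite /al -emb1 -embD /be bmulDr bmul1r -bmulA !bmulDl -!bmulA !ED !E_mull.
  rewrite bexp_alt_prodS bexp_alt_prod.
  rewrite -[c ** alt_prod a c true n.*2]/(alt_prod a c false n.*2.+1).
  rewrite -[c ** alt_prod a c true n.*2.+1]/(alt_prod a c false n.*2.+2).
  rewrite !(ac_free _ _.+1) // !bmul0r !addr0; case: n => [|n].
    by rewrite /= E1 bmul1r.
  by rewrite doubleS ac_free // bmul0r.
clearbody al be.
have partial n : E (al ** geom mA w n.+1 ** be) = oneB + b.
  elim: n => [|n IH]; first by rewrite /= add0r (term 0%N).
  rewrite -[geom mA w n.+2]/(geom mA w n.+1 + bexp mA w n.+1) bmulDr bmulDl ED IH.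
  by rewrite term /= addr0.
have [M M0 EM] := E_bounded; have w01 : 0 <= nm w < 1 by rewrite nm_ge0.
apply/eqP; rewrite -subr_eq0; apply/eqP/nm_eq0/eqP; rewrite eq_le nm_ge0 andbT.
apply/ler_addgt0Pr => e e0; rewrite add0r.
pose K := M * (nm al * nm oneA * nm z * nm be).
have [n hn] := geometric_small K w01 e0.
have hn1 : K * nm w ^+ n.+1 < e.
  apply: le_lt_trans hn; rewrite exprS; apply: ler_wpM2l.
    by rewrite !mulr_ge0 // nm_ge0.
  by apply: ler_piMl; [rewrite exprn_ge0 // nm_ge0 | exact: ltW].
rewrite (geom_remainder n.+1 zP) bmulDr bmulDl ED partial addrAC subrr add0r.
apply: le_trans (EM _) _; apply: le_trans (ltW hn1); rewrite /K -mulrA.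
apply: ler_wpM2l => //.
apply: le_trans (nm_bmul _ _ _) _; rewrite [leRHS]mulrAC.
apply: ler_wpM2r; first exact: nm_ge0.
apply: le_trans (nm_bmul _ _ _) _; rewrite -!mulrA.
apply: ler_wpM2l; first exact: nm_ge0.
apply: le_trans (nm_bmul _ _ _) _; rewrite [nm z * _]mulrC mulrA.
by apply: ler_wpM2r; [exact: nm_ge0 | exact: nm_bexp].
Qed.
End Free.
End Ncps.

(** * Multiplicativity *)

Lemma near_cvg0 (R : realType) (U V : normedModType R[i]) (f : U -> V) (P : V -> Prop) :
  f @ (0 : U) --> (0 : V) -> (\forall v \near (0 : V), P v) -> \forall h \near (0 : U), P (f h).
Proof.
move=> /cvg0P f0 /nearP[d d0 hd]; have [e e0 he] := f0 d d0.
by apply/nearP; exists e => // h /he; rewrite subr0; exact: hd.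
Qed.

Lemma cvg0_id (R : realType) (U : normedModType R[i]) : (fun h : U => h) @ (0 : U) --> (0 : U).
Proof. by apply/cvg0P => e e0; exists e => // h; rewrite subr0. Qed.

Arguments cvg0_id {R} U.

Lemma near_nm_lt1 (R : realType) (U V : normedModType R[i]) (f : U -> V) :
  f @ (0 : U) --> (0 : V) -> \forall h \near (0 : U), nm (f h) < 1.
Proof.
move=> f0; apply: (near_cvg0 (P := fun v => nm v < 1) f0).
by apply/nearP; exists 1.
Qed.

Lemma cvg0_comp (R : realType) (U V W : normedModType R[i]) (f : U -> V) (g : V -> W) (l : W) :
  f @ (0 : U) --> (0 : V) -> g @ (0 : V) --> l -> (fun h => g (f h)) @ (0 : U) --> l.
Proof. by move=> f0 gl; exact: (cvg_comp _ _ f0 gl). Qed.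

Section Multiplicativity.
Variables (R : realType) (B A : completeNormedModType R[i]).
Variables (mB : banach_alg B) (mA : banach_alg A) (iota : B -> A) (E : A -> B).
Hypothesis ncps : banach_ncps mB mA iota E.
Local Notation C := (R[i]^o).
Local Notation "x ** y" := (bmul mA x y) (at level 40, left associativity).
Local Notation "x *b y" := (bmul mB x y) (at level 40, left associativity).
Local Notation oneA := (bone mA).
Local Notation oneB := (bone mB).
Implicit Types (b : B).

Lemma cvg0_iota (U : normedModType R[i]) (f : U -> B) b :
  f @ (0 : U) --> b -> (fun h => iota (f h)) @ (0 : U) --> iota b.
Proof.
apply: (cvg0_linear (T := iota) (M := 1)) => [b1 b2|k b'|b'].
- exact: (embD ncps).
- exact: (embZ ncps).
- by rewrite (nm_iota ncps) mul1r.
Qed.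

Lemma holo_cvg0 (F : B -> B) : holo_near0 F -> F @ (0 : B) --> F 0.
Proof. by move=> /nbhs_singleton/differentiable_continuous. Qed.

(** * The moment equation of a single variable *)

Section Factor.
Variables (a : A) (Phi H : B -> B).
Hypotheses (H_holo : holo_near0 H)
  (PhiE : \forall b \near (0 : B), Phi b = b *b H b)
  (PsiK : \forall b \near (0 : B), Psi mB mA iota E a (Phi b) = b).

Let res b := binv mA (oneA - iota (b *b H b) ** a).

Lemma cvg0_factor : (fun b => iota (b *b H b) ** a) @ (0 : B) --> (0 : A).
Proof.
have := cvg0_bmul (m := mA)
  (cvg0_iota (cvg0_bmul (m := mB) (cvg0_id B) (holo_cvg0 H_holo))) (cvg0_cst B a).
by rewrite bmul0l (emb0 ncps) bmul0l.
Qed.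

Lemma cvg0_res : res @ (0 : B) --> oneA.
Proof.
have c1 := cvg0B (cvg0_cst B oneA) cvg0_factor.
rewrite subr0 in c1; have [_] := cvg0_binv (binvertible1 mA) c1.
by rewrite (@binvE _ _ mA oneA oneA) // bmul1l.
Qed.

Lemma cvg0_moment :
  (fun b => iota (H b) ** a ** res b) @ (0 : B) --> iota (H 0) ** a.
Proof.
have := cvg0_bmul (m := mA) (cvg0_bmul (m := mA)
  (cvg0_iota (holo_cvg0 H_holo)) (cvg0_cst B a)) cvg0_res.
by rewrite bmul1r.
Qed.

(* Multiplied by b on the left this is the equation Psi_a (Phi b) = b; the
   factor b is cancelled by the uniqueness of analytic left division. *)
Lemma E_moment : \forall b \near (0 : B), E (iota (H b) ** a ** res b) = oneB.
Proof.
have small := near_nm_lt1 cvg0_factor.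
have E_lin := ED ncps; have [M _ EM] := E_bounded ncps.
suff : \forall b \near (0 : B), E (iota (H b) ** a ** res b) - oneB = 0.
  by apply: filterS => b /eqP; rewrite subr_eq0 => /eqP.
apply: (left_division_unique (m := mB)).
  apply: filterS2 H_holo small => b Hb sb.
  have dl : cdiff (fun t : C => b + (t : R[i]) *: oneB) 0 by exact: cdiff_line.
  have b0 : b + (0 : R[i]) *: oneB = b by rewrite scale0r addr0.
  have dH : cdiff (fun t : C => H (b + (t : R[i]) *: oneB)) 0.
    by apply: cdiff_comp dl; rewrite b0.
  have di (f : C -> B) : cdiff f 0 -> cdiff (fun t => iota (f t)) 0.
    apply: (cdiff_linear (T := iota) (M := 1)) => [b1 b2|k b'|b'].
    - exact: (embD ncps).
    - exact: (embZ ncps).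
    - by rewrite (nm_iota ncps) mul1r.
  apply: cdiffB; last exact: cdiff_cst.
  apply: (cdiff_linear (T := E) (M := M)) => [||//|]; [exact: E_lin | exact: (EZ ncps) |].
  apply: cdiff_bmul.
    by apply: cdiff_bmul; [exact: di | exact: cdiff_cst].
  apply: cdiff_binv; first by rewrite /= b0; exact: neumann.
  apply: cdiffB; first exact: cdiff_cst.
  apply: cdiff_bmul; last exact: cdiff_cst.
  by apply: di; apply: cdiff_bmul.
apply: filterS3 small PhiE PsiK => b sb PhiE_b; rewrite PhiE_b => hb.
have resP : (oneA - iota (b *b H b) ** a) ** res b = oneA.
  by apply: bmulVr; exact: neumann.
rewrite bmulBr bmul1r -(E_mull ncps) !bmulA -(embM ncps).
have -> : iota (b *b H b) ** a ** res b = res b - oneA.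
  by rewrite -resP bmulBl bmul1l opprB addrC subrK.
by rewrite (EB ncps) (E1 ncps) -[in X in _ - X]hb /Psi subrr.
Qed.

(** The moment equation at b = 0, where the resolvent is 1. It supplies the invertibility of the
    S-transform near 0. *)
Lemma factor0 : H 0 *b E a = oneB.
Proof.
have := nbhs_singleton E_moment.
rewrite /res bmul0l (emb0 ncps) bmul0l subr0 (@binvE _ _ mA oneA oneA) ?bmul1l //.
by rewrite bmul1r (E_mull ncps).
Qed.
End Factor.

(** The terms b r b t cancel, and the remaining b r + b t - b r t differs from - b (r - 1)(t - 1)
    exactly by b. *)
Lemma alternating_identity (b r t : A) :
  (oneA + b ** r) ** (oneA + b ** t) - b ** r ** ((oneA + b) ** t)
  = oneA + b - b ** (r - oneA) ** (t - oneA).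
Proof.
rewrite !(bmulDl, bmulDr, bmulBl, bmulBr, bmul1l, bmul1r, bmulNl, bmulNr) !opprD !opprK !bmulA.
rewrite !addrA [LHS](ACl (1 * 2 * 3 * 5 * (4 * 6))) /= subrr addr0.
by rewrite [RHS](ACl (1 * 4 * 5 * 3 * (2 * 6))) /= subrr addr0.
Qed.

(** The algebra at a single b, with all smallness conditions as hypotheses. The inverse [v] of 1 + b
    normalises N to 1 - (v b rho) tau, whose two factors are centred and lie in the closed algebras
    of x and of y. *)
Lemma Psi_mul (x y : A) (b b' s h k v : B) :
  free_in mA iota E x y ->
  let U := binv mA (oneA - iota (b' *b k) ** x) in
  let W := binv mA (oneA - iota (b *b h) ** y) in
  let rho := iota s ** (iota k ** x ** U - oneA) ** iota (binv mB s) in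
  let tau := iota h ** y ** W - oneA in
  binvertible mB s -> s = (oneB + b) *b h -> s *b b' = b *b s ->
  v *b (oneB + b) = oneB ->
  nm (iota (b' *b k) ** x) < 1 -> E (iota k ** x ** U) = oneB ->
  nm (iota (b *b h) ** y) < 1 -> E (iota h ** y ** W) = oneB ->
  nm (iota (v *b b) ** rho ** tau) < 1 ->
  nm (iota (b *b (s *b k)) ** (x ** y)) < 1 ->
  Psi mB mA iota E (x ** y) (b *b (s *b k)) = b.
Proof.
move=> xy_free U W rho tau si sE sb vb ux EU wy EW qrt cxy.
pose s' := binv mB s.
have iM := embM ncps.
have ss' : s *b s' = oneB by exact: bmulVr.
have s's : s' *b s = oneB by exact: bmulVl.
have [Ur Ul] := binvP (neumann mA ux); rewrite -/U in Ur Ul.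
have [Wr Wl] := binvP (neumann mA wy); rewrite -/W in Wr Wl.
pose r := iota k ** x ** U; pose t := iota h ** y ** W.
have UE : U = oneA + iota b' ** r.
  by rewrite -Ur bmulBl bmul1l /r !bmulA -iM subrK.
have WE : W = oneA + iota b ** t.
  by rewrite -Wr bmulBl bmul1l /t !bmulA -iM subrK.
pose r' := iota s ** r ** iota s'.
have rhoE : rho = r' - oneA.
  by rewrite /rho -/s' -/r bmulBr bmul1r bmulBl -iM ss' (emb1 ncps).
have U'E : iota s ** U ** iota s' = oneA + iota b ** r'.
  by rewrite UE bmulDr bmul1r bmulDl -iM ss' (emb1 ncps) !bmulA -iM sb iM.
set c := b *b (s *b k); rewrite -/c in cxy.
have cE : c = s *b (b' *b k) by rewrite /c !bmulA sb.
have Upx : U ** (iota (b' *b k) ** x) = U - oneA.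
  by rewrite -Ul bmulBr bmul1r opprB addrC subrK.
have syW : iota s ** y ** W = (oneA + iota b) ** t.
  by rewrite sE iM (embD ncps) (emb1 ncps) /t !bmulA.
(* In the cross term c = s b' k cancels s^-1, then U b' k x = U - 1, and [syW] replaces s y W by (1
   + b) t. *)
have N : iota s ** U ** iota s' ** (oneA - iota c ** (x ** y)) ** W
    = oneA + iota b - iota b ** rho ** tau.
  rewrite rhoE -alternating_identity -WE -U'E bmulBr bmul1r bmulBl; congr (_ - _).
  have -> : iota s ** U ** iota s' ** (iota c ** (x ** y))
      = iota s ** (U ** (iota (b' *b k) ** x)) ** y.
    by rewrite cE iM !bmulA -(bmulA mA _ (iota s') (iota s)) -iM s's (emb1 ncps) bmul1r.
  rewrite Upx bmulBr bmul1r !bmulBl syW.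
  have -> : iota s ** U ** y ** W = iota s ** U ** iota s' ** ((oneA + iota b) ** t).
    rewrite -syW !bmulA -(bmulA mA _ (iota s') (iota s)) -iM s's (emb1 ncps) bmul1r //.
  by rewrite U'E bmulDl bmul1l addrC addKr.
set Z := binv mA (oneA - iota (v *b b) ** rho ** tau).
have Zl : Z ** (oneA - iota (v *b b) ** rho ** tau) = oneA.
  by apply: bmulVl; exact: neumann.
have vN : iota v ** (oneA + iota b - iota b ** rho ** tau)
    = oneA - iota (v *b b) ** rho ** tau.
  rewrite bmulBr -(emb1 ncps) -(embD ncps) -iM vb; congr (_ - _).
  by rewrite iM !bmulA.
have vU : iota v ** (iota s ** U ** iota s') = oneA + iota (v *b b) ** rho.
  have -> : iota s ** U ** iota s' = oneA + iota b + iota b ** rho.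
    by rewrite U'E rhoE bmulBr bmul1r -addrA [iota b + _]addrC subrK.
  by rewrite bmulDr -{1}(emb1 ncps) -(embD ncps) -iM vb (emb1 ncps) iM bmulA.
(* A left inverse is enough, as 1 - c x y is already invertible. Multiplied by W on the right, the
   product collapses to W, which is then cancelled by its inverse 1 - b h y. *)
have ME : W ** Z ** iota v ** (iota s ** U ** iota s') = binv mA (oneA - iota c ** (x ** y)).
  apply: left_right_inv (bmulVr (neumann mA cxy)).
  set M := oneA - iota c ** (x ** y) in N *; set U' := iota s ** U ** iota s' in N vU *.
  have e : W ** Z ** iota v ** U' ** M ** W = W.
    rewrite -(bmulA mA (W ** Z ** iota v) U') -(bmulA mA (W ** Z ** iota v)) N.
    by rewrite -bmulA vN -bmulA Zl bmul1r.
  have : W ** Z ** iota v ** U' ** M ** W ** (oneA - iota (b *b h) ** y) = oneA.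
    by rewrite e Wl.
  by rewrite -bmulA Wl bmul1r.
(* Together with [vU] this puts the resolvent in the form required by [E_free_resolvent], with v b
   rho as the first centred factor and tau as the second. *)
have WE' : W = oneA + iota b + iota b ** tau.
  by rewrite WE /tau -/t bmulBr bmul1r addrA addrAC addrK.
have clr z d : alg_closure mA iota x z -> alg_closure mA iota x (iota d ** z).
  by move=> xz; apply: alg_closureM => //; exact: alg_closure_iota.
have xU : alg_closure mA iota x U.
  apply: (alg_closure_binv ncps) => //; apply: (clr _ _); apply: alg_closure_gen; exact: gen_x.
have yW : alg_closure mA iota y W.
  apply: (alg_closure_binv ncps) => //; apply: alg_closureM; first exact: alg_closure_iota.
  by apply: alg_closure_gen; exact: gen_x.
have x1 (u : A) : alg_closure mA iota u oneA.
  by rewrite -(emb1 ncps); exact: alg_closure_iota.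
have xrho : alg_closure mA iota x rho.
  apply: alg_closureM; last exact: alg_closure_iota.
  apply: (clr _ _); apply: (alg_closureB ncps) => //; apply: alg_closureM => //.
  by apply: (clr _ _); apply: alg_closure_gen; exact: gen_x.
have ytau : alg_closure mA iota y tau.
  apply: (alg_closureB ncps) => //; apply: alg_closureM => //; apply: alg_closureM.
    exact: alg_closure_iota.
  by apply: alg_closure_gen; exact: gen_x.
have Etau : E tau = 0 by rewrite (EB ncps) EW (E1 ncps) subrr.
have Erho : E (iota (v *b b) ** rho) = 0.
  by rewrite (E_mull ncps) (E_mulr ncps) (E_mull ncps) (EB ncps) EU (E1 ncps) subrr
     bmul0r bmul0l bmul0r.
rewrite /Psi -ME -bmulA vU WE'.
by rewrite (E_free_resolvent ncps xy_free _ (clr _ _ xrho) Erho ytau Etau qrt) addrC addKr.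
Qed.
End Multiplicativity.

Unset Implicit Arguments.
Set Strict Implicit.

Theorem theorem1p1 (R : realType)
    (B A : completeNormedModType R[i]) (mB : banach_alg B) (mA : banach_alg A)
    (iota : B -> A) (E : A -> B) (x y : A) :
  banach_ncps mB mA iota E ->
  free_in mA iota E x y ->
  binvertible mB (E x) -> binvertible mB (E y) ->
  forall Sx Sy Sxy : B -> B,
    is_S_transform mB mA iota E x Sx ->
    is_S_transform mB mA iota E y Sy ->
    is_S_transform mB mA iota E (bmul mA x y) Sxy ->
    \forall b \near (0 : B),
      Sxy b = bmul mB (Sy b)
                (Sx (bmul mB (bmul mB (binv mB (Sy b)) b) (Sy b))).
Proof.
move=> ncps xy_free _ [Ey' [EyV _]] Sx Sy Sxy.
move=> [_ [Phix [Hx [[_ _ Psix _] [Hx_holo PhixE SxE]]]]].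
move=> [_ [Phiy [Hy [[_ _ Psiy _] [Hy_holo PhiyE SyE]]]]].
move=> [_ [Phi [H [[_ _ _ PhiK] [H_holo PhiE SxyE]]]]].
have Fx := E_moment ncps Hx_holo PhixE Psix.
have Fy := E_moment ncps Hy_holo PhiyE Psiy.
have Hy0 := factor0 ncps Hy_holo PhiyE Psiy.
(* H_y(0) is a left inverse of the invertible E y, hence its two-sided inverse. As s(0) = H_y(0),
   s(b) is invertible for b near 0. *)
have Hy0i : binvertible mB (Hy 0).
  by exists (E y); split=> //; rewrite (left_right_inv Hy0 EyV).
(* [Sy] agrees with [s] only near 0; the explicit formula is what limits and derivatives are
   computed with. *)
pose s b := bmul mB (bone mB + b) (Hy b).
pose b' b := bmul mB (bmul mB (binv mB (s b)) b) (s b).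
pose v b := binv mB (bone mB + b).
pose c b := bmul mB b (bmul mB (s b) (Hx (b' b))).
have cvg1 : (fun b => bone mB + b) @ (0 : B) --> bone mB.
  by have := cvg0D (cvg0_cst B (bone mB)) (cvg0_id B); rewrite addr0.
have cvgs : s @ (0 : B) --> Hy 0.
  by have := cvg0_bmul (m := mB) cvg1 (holo_cvg0 Hy_holo); rewrite bmul1l.
have [si cvgsV] := cvg0_binv Hy0i cvgs.
have [oi cvgv] := cvg0_binv (binvertible1 mB) cvg1.
(* Since b' tends to 0 with b, every statement about x near 0 can be pulled back along b'; the same
   is done with c for x y. *)
have cvgb' : b' @ (0 : B) --> (0 : B).
  have := cvg0_bmul (m := mB) (cvg0_bmul (m := mB) cvgsV (cvg0_id B)) cvgs.
  by rewrite bmul0r bmul0l.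
have cvgHx : (fun b => Hx (b' b)) @ (0 : B) --> Hx 0.
  exact: cvg0_comp cvgb' (holo_cvg0 Hx_holo).
have cvgc : c @ (0 : B) --> (0 : B).
  have := cvg0_bmul (m := mB) (cvg0_id B) (cvg0_bmul (m := mB) cvgs cvgHx).
  by rewrite bmul0l.
pose mx b := bmul mA (bmul mA (iota (Hx b)) x)
  (binv mA (bone mA - bmul mA (iota (bmul mB b (Hx b))) x)).
pose my b := bmul mA (bmul mA (iota (Hy b)) y)
  (binv mA (bone mA - bmul mA (iota (bmul mB b (Hy b))) y)).
pose rho b := bmul mA (bmul mA (iota (s b)) (mx (b' b) - bone mA)) (iota (binv mB (s b))).
pose tau b := my b - bone mA.
have qrt : \forall b \near (0 : B),
    nm (bmul mA (bmul mA (iota (bmul mB (v b) b)) (rho b)) (tau b)) < 1.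
  apply: near_nm_lt1.
  have cvgmx := cvg0_comp cvgb' (cvg0_moment ncps (a := x) Hx_holo).
  have cvgrho := cvg0_bmul (m := mA) (cvg0_bmul (m := mA) (cvg0_iota ncps cvgs)
    (cvg0B cvgmx (cvg0_cst B (bone mA)))) (cvg0_iota ncps cvgsV).
  have cvgtau := cvg0B (cvg0_moment ncps (a := y) Hy_holo) (cvg0_cst B (bone mA)).
  have := cvg0_bmul (m := mA) (cvg0_bmul (m := mA)
    (cvg0_iota ncps (cvg0_bmul (m := mB) cvgv (cvg0_id B))) cvgrho) cvgtau.
  by rewrite bmul0r (emb0 ncps) !bmul0l.
have cxy : \forall b \near (0 : B), nm (bmul mA (iota (c b)) (bmul mA x y)) < 1.
  apply: near_nm_lt1.
  have := cvg0_bmul (m := mA) (cvg0_iota ncps cvgc) (cvg0_cst B (bmul mA x y)).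
  by rewrite (emb0 ncps) bmul0l.
have ux := near_cvg0 cvgb' (near_nm_lt1 (cvg0_factor ncps x Hx_holo)).
have uy := near_nm_lt1 (cvg0_factor ncps y Hy_holo).
have {}Fx := near_cvg0 cvgb' Fx.
have {}PhiK := near_cvg0 cvgc PhiK.
have sb b : binvertible mB (s b) -> bmul mB (s b) (b' b) = bmul mB b (s b).
  by move=> sbi; rewrite /b' !bmulA bmulVr // bmul1l.
(* Applying [Phi] to Psi_xy(c) = b gives c = Phi b = b H(b), while c = b s H_x(b') by definition. *)
have cE : \forall b \near (0 : B), bmul mB b (H b - bmul mB (s b) (Hx (b' b))) = 0.
  near=> b; rewrite bmulBr -/(c b).
  have <- : Phi b = bmul mB b (H b) by near: b.
  have Psic : Psi mB mA iota E (bmul mA x y) (c b) = b.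
    apply: (Psi_mul ncps (h := Hy b) (v := v b) (b' := b' b) xy_free) => //.
    - by near: b.
    - by apply: sb; near: b.
    - by apply: bmulVl; near: b.
    - by near: b.
    - by near: b.
    - by near: b.
    - by near: b.
    - by near: b.
    - by near: b.
  have PhiKc : Phi (Psi mB mA iota E (bmul mA x y) (c b)) = c b by near: b.
  by rewrite Psic in PhiKc; rewrite PhiKc subrr.
have HE : \forall b \near (0 : B), H b - bmul mB (s b) (Hx (b' b)) = 0.
  (* What remains is differentiability along b + t 1 of H and of s H_x(b'), the latter through the
     inverse of s inside b'. *)
  apply: left_division_unique cE.
  have {}Hx_holo := near_cvg0 cvgb' Hx_holo.
  near=> b.
  have dl : cdiff (fun t : R[i]^o => b + (t : R[i]) *: bone mB) 0 by exact: cdiff_line.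
  have b0 : b + (0 : R[i]) *: bone mB = b by rewrite scale0r addr0.
  have dH (F : B -> B) : differentiable F b ->
      cdiff (fun t : R[i]^o => F (b + (t : R[i]) *: bone mB)) 0.
    by move=> Fb; apply: cdiff_comp dl; rewrite b0.
  have ds : cdiff (fun t : R[i]^o => s (b + (t : R[i]) *: bone mB)) 0.
    apply: cdiff_bmul; first by apply: cdiffD => //; exact: cdiff_cst.
    by apply: dH; near: b.
  apply: cdiffB; first by apply: dH; near: b.
  apply: cdiff_bmul => //; apply: cdiff_comp; first by rewrite b0; near: b.
  apply: cdiff_bmul => //; apply: cdiff_bmul => //.
  by apply: cdiff_binv => //; rewrite b0; near: b.
have {}SxE := near_cvg0 cvgb' SxE.
near=> b.
have -> : Sxy b = bmul mB (bone mB + b) (H b) by near: b.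
have -> : Sy b = s b by near: b.
rewrite -/(b' b).
have -> : Sx (b' b) = bmul mB (bone mB + b' b) (Hx (b' b)) by near: b.
have /eqP : H b - bmul mB (s b) (Hx (b' b)) = 0 by near: b.
rewrite subr_eq0 => /eqP ->.
have sbi : binvertible mB (s b) by near: b.
(* The last equality is (1 + b) s = s (1 + b'), a restatement of s b' = b s. *)
move: (Hx (b' b)) (sb b sbi); move: (s b) (b' b) => s0 b0 k0 sb0.
by rewrite !bmulA bmulDl bmulDr bmul1l bmul1r sb0.
Unshelve. all: by end_near.
Qed.
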